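(* Let $G$ be a $2$-connected cubic graph with $\mathrm{df}(G)=3$ and let $C$ be a hexagonal core of $G$. Then $G$ admits a decomposition $\mathcal{D}=\{G_1,\dots,G_m\}$ (along small independent edge cuts) such that all decomposition factors are cyclically $4$-edge-connected, except possibly $G_1$, and the following hold: (i) $\mathrm{df}(G_1)=3$ and $C$ is a hexagonal core of $G_1$; (ii) each $G_i$ with $i\ge 2$ is $3$-edge-colourable; (iii) if $G_1$ is not cyclically $4$-edge-connected, then it contains a triangle $T$ such that $C$ intersects $T$ and $G_1/T$ (obtained by contracting $T$ to a single vertex) is cyclically $4$-edge-connected. Moreover, $G$ can be reconstructed from $\mathcal{D}$ by repeated application of $2$-sums and $3$-sums.
   Context: Graphs are finite; loops and multiple edges are allowed. A $3$-array of a bridgeless cubic graph $H$ is a set $\mathcal{M}$ of three perfect matchings of $H$; an edge is uncovered if it lies in none of them and simply covered if it lies in exactly one. The colouring defect $\mathrm{df}(H)$ is the minimum number of uncovered edges over all $3$-arrays; a $3$-array attaining it is optimal. The core of $\mathcal{M}$ is the subgraph formed by all edges not simply covered. When $\mathrm{df}(H)=3$ the core of every optimal $3$-array is an induced $6$-cycle, called a hexagonal core. A connected graph is cyclically $k$-edge-connected if removing fewer than $k$ edges cannot produce two components containing circuits. An edge cut is independent if its edges are pairwise non-adjacent, and small if it has $2$ or $3$ edges. For a small independent edge cut $R$ with components $L_1,L_2$ of $G-R$, the completion $\bar L_i$ is $L_i$ plus an edge joining its two $2$-valent vertices (if $|R|=2$) or $L_i$ plus a new vertex adjacent to its three $2$-valent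 vertices (if $|R|=3$); the decomposition along $R$ is $\{\bar L_1,\bar L_2\}$. A decomposition of $G$ is defined recursively: $\{G\}$ is one, and replacing a member by its decomposition along one of its small independent edge cuts gives another. A $2$-sum of $2$-connected cubic graphs $H,K$ with distinguished edges $e,f$ deletes $e,f$ and joins the $2$-valent vertices of $H-e$ to those of $K-f$ by two new independent edges; a $3$-sum with distinguished vertices $u,v$ deletes $u,v$ and joins the three dangling edge-ends formerly at $u$ bijectively to those formerly at $v$. *)

(* Defs.v *)
From HB Require Import structures.
From mathcomp Require Import all_boot.
From Stdlib Require Permutation.

Set Implicit Arguments.
Unset Strict Implicit.
Unset Printing Implicit Defensive.

(* A finite multigraph: each edge e has two ends (gends e false) and
   (gends e true); a loop has both ends equal; parallel edges are allowed. *)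
Record graph := Graph {
  gV : finType;
  gE : finType;
  gends : gE -> bool -> gV }.

Section Basics.
Variable G : graph.
Notation V := (gV G).
Notation E := (gE G).
Notation ends := (@gends G).

Definition joins (e : E) (x y : V) : bool :=
  ((ends e false == x) && (ends e true == y)) ||
  ((ends e false == y) && (ends e true == x)).

(* number of edge-ends (darts) of edges of F at v: a loop counts twice *)
Definition ddeg (F : {set E}) (v : V) : nat :=
  #|[set d : E * bool | (d.1 \in F) && (ends d.1 d.2 == v)]|.

Definition cubic : Prop := forall v, ddeg setT v = 3.

Definition adjrel (X : {set V}) (F : {set E}) : rel V :=
  [rel x y | [&& x \in X, y \in X & [exists e in F, joins e x y]]].

Definition connected_on (X : {set V}) (F : {set E}) : Prop :=
  X != set0 /\ {in X &, forall x y, connect (adjrel X F) x y}.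

Definition connected : Prop := connected_on setT setT.

Definition noinc (v : V) (e : E) : bool := [forall b, ends e b != v].

Definition twoconn : Prop :=
  [/\ connected, 1 < #|V|, (forall e, ends e false != ends e true)
    & forall v, connected_on [set~ v] [set e | noinc v e]].

Definition touched (Z : {set E}) : {set V} :=
  [set v | [exists e in Z, exists b, ends e b == v]].

Definition circuit (Z : {set E}) : Prop :=
  [/\ Z != set0, (forall v, ddeg Z v = 0 \/ ddeg Z v = 2)
    & connected_on (touched Z) Z].

Definition cyc_conn (k : nat) : Prop :=
  connected /\
  forall F : {set E}, #|F| < k ->
  forall Z1 Z2 : {set E}, circuit Z1 -> circuit Z2 ->
    [disjoint Z1 & F] -> [disjoint Z2 & F] ->
    forall x y, x \in touched Z1 -> y \in touched Z2 ->
      connect (adjrel setT (~: F)) x y.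

Definition colourable3 : Prop :=
  exists c : E -> 'I_3, forall d1 d2 : E * bool,
    ends d1.1 d1.2 = ends d2.1 d2.2 -> d1 != d2 -> c d1.1 != c d2.1.

Definition perfect_matching (M : {set E}) : Prop := forall v, ddeg M v = 1.

Definition array3 (A : {set {set E}}) : Prop :=
  #|A| = 3 /\ forall M, M \in A -> perfect_matching M.

Definition cov (A : {set {set E}}) (e : E) : nat := #|[set M in A | e \in M]|.

Definition uncovered (A : {set {set E}}) : {set E} := [set e | cov A e == 0].

Definition defect (k : nat) : Prop :=
  (exists A, array3 A /\ #|uncovered A| = k) /\
  forall A, array3 A -> k <= #|uncovered A|.

Definition optimal (A : {set {set E}}) : Prop :=
  array3 A /\ forall A', array3 A' -> #|uncovered A| <= #|uncovered A'|.

Definition core (A : {set {set E}}) : {set E} := [set e | cov A e != 1].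

(* C is a (hexagonal, when df = 3) core of G: the core of an optimal 3-array *)
Definition hexcore (C : {set E}) : Prop := exists A, optimal A /\ core A = C.

Definition inside (X : {set V}) (e : E) : bool :=
  (ends e false \in X) && (ends e true \in X).

Definition cut (X : {set V}) : {set E} :=
  [set e | (ends e false \in X) != (ends e true \in X)].

Definition xend (X : {set V}) (e : E) : V :=
  if ends e false \in X then ends e false else ends e true.

Definition independent (R : {set E}) : Prop :=
  forall e f, e \in R -> f \in R -> e != f -> forall b b', ends e b != ends f b'.

(* R = cut X is an independent edge cut and G - R has exactly the two
   components G[X] and G[~X] *)
Definition indep_cut (X : {set V}) : Prop :=
  [/\ connected_on X setT, connected_on (~: X) setT & independent (cut X)].

End Basics.

Arguments cubic : clear implicits.
Arguments connected : clear implicits.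
Arguments twoconn : clear implicits.
Arguments cyc_conn : clear implicits.
Arguments colourable3 : clear implicits.
Arguments defect : clear implicits.
Arguments hexcore : clear implicits.

Definition contract (G : graph) (S : {set gV G}) (F : {set gE G}) : graph :=
  @Graph (option {v : gV G | v \notin S}) {e : gE G | e \notin F}
    (fun e b => insub (gends (val e) b)).

Definition contract_map (G : graph) (S : {set gV G}) (F : {set gE G}) :
  gE (contract S F) -> option (gE G) := fun e => Some (val e).

(* completion along a 3-cut cut X: side X plus a new vertex (None) adjacent
   to the three 2-valent vertices; the new edges are the cut edges *)
Definition compl3 (G : graph) (X : {set gV G}) : graph :=
  contract (~: X) [set e | inside (~: X) e].

(* completion along a 2-cut {r false, r true} = cut X: side X plus one new
   edge (inr tt) joining its two 2-valent vertices *)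
Definition compl2 (G : graph) (X : {set gV G}) (r : bool -> gE G)
  (hr : forall b, xend X (r b) \in X) : graph :=
  let d0 : {v : gV G | v \in X} := exist _ (xend X (r false)) (hr false) in
  @Graph {v : gV G | v \in X} ({e : gE G | inside X e} + unit)%type
    (fun k b => match k with
                | inl e => insubd d0 (gends (val e) b)
                | inr _ => insubd d0 (xend X (r b))
                end).

Definition compl2_map (G : graph) (X : {set gV G})
  : ({e : gE G | inside X e} + unit)%type -> option (gE G) :=
  fun k => match k with inl e => Some (val e) | inr _ => None end.

(* a decomposition factor: a graph together with the map sending its edges
   to the edges of the original graph they come from (None for the new
   edge of a 2-cut completion) *)
Definition factor (G : graph) := {H : graph & gE H -> option (gE G)}.

Inductive decomp (G : graph) : seq (factor G) -> Prop :=
| dec_base : decomp [:: existT _ G (@Some (gE G))]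
| dec_perm s s' : decomp s -> Permutation.Permutation s s' -> decomp s'
| dec_cut2 (H : graph) (phi : gE H -> option (gE G)) s (X : {set gV H})
    (r : bool -> gE H) (hr1 : forall b, xend X (r b) \in X)
    (hr2 : forall b, xend (~: X) (r b) \in ~: X) :
    decomp (existT _ H phi :: s) ->
    indep_cut X -> cut X = [set r false; r true] -> r false != r true ->
    decomp (existT (fun K => gE K -> option (gE G)) (compl2 hr1)
              (fun k => obind phi (compl2_map k))
            :: existT (fun K => gE K -> option (gE G)) (compl2 hr2)
              (fun k => obind phi (compl2_map k)) :: s)
| dec_cut3 (H : graph) (phi : gE H -> option (gE G)) s (X : {set gV H}) :
    decomp (existT _ H phi :: s) ->
    indep_cut X -> #|cut X| = 3 ->
    decomp (existT (fun K => gE K -> option (gE G)) (compl3 X)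
              (fun k => obind phi (contract_map k))
            :: existT (fun K => gE K -> option (gE G)) (compl3 (~: X))
              (fun k => obind phi (contract_map k)) :: s).

Definition sum2 (H K : graph) (e : gE H) (f : gE K) (sg : bool) : graph :=
  @Graph (gV H + gV K)%type ({x : gE H | x != e} + {y : gE K | y != f} + bool)%type
    (fun k b => match k with
                | inl (inl x) => inl (gends (val x) b)
                | inl (inr y) => inr (gends (val y) b)
                | inr n => if b then inr (gends f (addb n sg)) else inl (gends e n)
                end).

Lemma noinc_end (G : graph) (u : gV G) (e : gE G) :
  noinc u e -> forall b, gends e b != u.
Proof. by move=> /forallP. Qed.

Definition darts (G : graph) (u : gV G) := {d : gE G * bool | gends d.1 d.2 == u}.
Definition other (G : graph) (d : gE G * bool) : gV G := gends d.1 (~~ d.2).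

Definition sum3 (H K : graph) (u : gV H) (v : gV K)
  (hu : forall d : darts u, other (val d) != u)
  (hv : forall d : darts v, other (val d) != v)
  (beta : darts u -> darts v) : graph :=
  @Graph ({x : gV H | x != u} + {y : gV K | y != v})%type
    ({x : gE H | noinc u x} + {y : gE K | noinc v y} + darts u)%type
    (fun k b => match k with
                | inl (inl x) => inl (exist _ (gends (val x) b) (noinc_end (valP x) b))
                | inl (inr y) => inr (exist _ (gends (val y) b) (noinc_end (valP y) b))
                | inr d => if b then inr (exist _ (other (val (beta d))) (hv (beta d)))
                           else inl (exist _ (other (val d)) (hu d))
                end).

Definition giso (G H : graph) : Prop :=
  exists (fV : gV G -> gV H) (fE : gE G -> gE H),
    [/\ bijective fV, bijective fE &
      forall e, (gends (fE e) false = fV (gends e false) /\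
                 gends (fE e) true = fV (gends e true)) \/
                (gends (fE e) false = fV (gends e true) /\
                 gends (fE e) true = fV (gends e false))].

Inductive recon : graph -> seq graph -> Prop :=
| rc_leaf H : recon H [:: H]
| rc_iso H H' s : recon H s -> giso H H' -> recon H' s
| rc_perm H s s' : recon H s -> Permutation.Permutation s s' -> recon H s'
| rc_sum2 H K sH sK (e : gE H) (f : gE K) sg :
    recon H sH -> recon K sK -> cubic H -> cubic K -> twoconn H -> twoconn K ->
    recon (sum2 e f sg) (sH ++ sK)
| rc_sum3 H K sH sK (u : gV H) (v : gV K) hu hv (beta : darts u -> darts v) :
    recon H sH -> recon K sK -> cubic H -> cubic K -> twoconn H -> twoconn K ->
    bijective beta -> recon (@sum3 H K u v hu hv beta) (sH ++ sK).

Definition pull (G H : graph) (phi : gE H -> option (gE G)) (C : {set gE G})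
  : {set gE H} := [set k | if phi k is Some c then c \in C else false].

(* Main.v *)
(* Let [m] be a 3-array with three uncovered edges. Since [G] is not 3-edge-colourable, any two of
   the matchings meet, which forces exactly one edge [D i] in [m j :&: m k] and no triple edge. A side
   [Z] of a cut with at most three edges that misses some [D i] is 3-edge-coloured by two of the
   matchings; as two coloured sides could be glued, exactly one side [Z] is coloured, and each [D j]
   at [Z] lies in the cut. Counting these edges, either [Z] contains a set avoiding the core whose cut
   has at most three edges, or [Z] is a triangle meeting the core. Sets avoiding the core are split
   off, as their completions are 3-edge-colourable and can be decomposed freely; the array restricts
   to the other completion. Once no such set is left, every nontrivial small cut bounds a triangle,
   and two disjoint ones would give a 3-edge-colouring by a Kempe exchange, so that contracting one
   triangle destroys all nontrivial small cuts. *)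
Require Import Defs.
From HB Require Import structures.
From mathcomp Require Import all_boot.
From Stdlib Require Permutation.
From mathcomp Require Import fingroup perm zify.

Set Implicit Arguments.
Unset Strict Implicit.
Unset Printing Implicit Defensive.

(** The exception in (iii) has a definite cause. When a triangle meets the core, all three edges of
    its cut lie in one matching [m i], so after contraction [m i] would cover the new vertex three
    times and the array does not restrict. Across the cut of a set avoiding the core every edge is
    simply covered; parity then makes each matching use exactly one edge of a 3-cut, and both or
    neither of a 2-cut. Optimality of a restricted array needs no comparison with arrays of the
    larger graph: in an uncolourable graph every array misses at least three edges, so it is enough
    that the restriction misses at most three and that the factor is uncolourable. A small cut need
    not be independent. A vertex with two cut edges is then moved across, which lowers the cut to
    two edges; it has to be checked that this vertex is not on the core. *)

Ltac nlia :=
  repeat match goal with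
  | H : is_true (leq _ _) |- _ => revert H
  | H : @eq nat _ _ |- _ => revert H
  | H : @eq bool (odd _) _ |- _ => revert H
  | H : is_true (~~ odd _) |- _ => revert H
  end; clear; intros; lia.

(** * Edge cuts of cubic graphs *)

(* Without loops, the set of edges incident with [v]. *)
Notation star v := (cut [set v]).
Notation loopless G := (forall e : gE G, gends e false != gends e true).

Section Cuts.
Variable G : graph.
Implicit Types (X Y : {set gV G}) (F : {set gE G}) (e : gE G) (v w : gV G).

Lemma in_cut X e : (e \in cut X) = (gends e false \in X) (+) (gends e true \in X).
Proof. by rewrite inE; do 2 case: (_ \in X). Qed.

Lemma in_cut_end X e b :
  (e \in cut X) = (gends e b \in X) (+) (gends e (~~ b) \in X).
Proof. by rewrite in_cut; case: b => //=; rewrite addbC. Qed.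

Lemma cutC X : cut (~: X) = cut X.
Proof. by apply/setP=> e; rewrite !inE; do 2 case: (_ \in X). Qed.

Lemma insideE X e b :
  inside X e = (gends e b \in X) && (gends e (~~ b) \in X).
Proof. by rewrite /inside; case: b => //=; rewrite andbC. Qed.

Lemma inside_cut X e : inside X e -> e \notin cut X.
Proof. by rewrite /inside in_cut => /andP [-> ->]. Qed.

Lemma in_cut_diff X Y e : Y \subset X ->
  (e \in cut (X :\: Y)) = (e \in cut X) (+) (e \in cut Y).
Proof.
move=> /subsetP sYX; have h x : (x \in X :\: Y) = (x \in X) (+) (x \in Y).
  by rewrite !inE; case: (boolP (x \in Y)) => [/sYX ->|_] //=; rewrite addbF.
by rewrite !in_cut !h addbACA.
Qed.

Lemma in_cut_del X v e : v \in X ->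
  (e \in cut (X :\ v)) = (e \in cut X) (+) (e \in star v).
Proof. by move=> vX; rewrite in_cut_diff ?sub1set. Qed.

Lemma in_cut_add X v e : v \notin X ->
  (e \in cut (v |: X)) = (e \in cut X) (+) (e \in star v).
Proof.
move=> hv; have h x : (x \in v |: X) = (x \in X) (+) (x \in [set v]).
  by rewrite !inE; case: eqP => [->|_]; rewrite ?(negbTE hv) //= addbF.
by rewrite !in_cut !h addbACA.
Qed.

(** The additive form avoids truncated subtraction. Moving a vertex across a cut changes the cut by
    the symmetric difference with its star, so in a cubic graph moving a vertex with two cut edges
    lowers the cut by one edge. *)
Lemma card_symdiff (T : finType) (A B C : {set T}) :
  (forall x, (x \in C) = (x \in A) (+) (x \in B)) ->
  #|C| + 2 * #|A :&: B| = #|A| + #|B|.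
Proof.
move=> h; have -> : C = (A :\: B) :|: (B :\: A).
  by apply/setP=> x; rewrite h !inE; case: (x \in A); case: (x \in B).
have hd : (A :\: B) :&: (B :\: A) = set0.
  by apply/setP=> x; rewrite !inE; case: (x \in A); case: (x \in B).
have := cardsUI (A :\: B) (B :\: A); rewrite hd cards0.
have := cardsID B A; have := cardsID A B; rewrite [B :&: A]setIC; lia.
Qed.

Lemma cut_del X v : v \in X ->
  #|cut (X :\ v)| + 2 * #|cut X :&: star v| = #|cut X| + #|star v|.
Proof. by move=> hv; apply: card_symdiff => e; exact: in_cut_del. Qed.

Lemma cut_add X v : v \notin X ->
  #|cut (v |: X)| + 2 * #|cut X :&: star v| = #|cut X| + #|star v|.
Proof. by move=> hv; apply: card_symdiff => e; exact: in_cut_add. Qed.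

Lemma starP e v : e \in star v -> exists b, gends e b = v.
Proof.
by rewrite in_cut !inE; case: eqP => [|_ /eqP]; [exists false|exists true].
Qed.

Lemma cut0 : cut (set0 : {set gV G}) = set0.
Proof. by apply/setP=> e; rewrite !inE. Qed.

Lemma cutT : cut [set: gV G] = set0.
Proof. by apply/setP=> e; rewrite !inE. Qed.

Lemma cutP X e : e \in cut X -> exists b, gends e b \in X /\ gends e (~~ b) \notin X.
Proof.
rewrite in_cut; case h1: (_ \in X); case h2: (_ \in X) => //= _.
  by exists false; rewrite h1 h2.
by exists true; rewrite h1 h2.
Qed.

(** Turns connectivity into a statement on cuts. A path leaving [A] has a first edge that crosses;
    conversely [A] is taken as the set of vertices reachable from [x]. *)
Lemma connect_onP X F : connected_on X F <->
  X != set0 /\ forall A : {set gV G}, A \subset X -> A != set0 -> A != X ->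
    exists e, [/\ e \in F, e \in cut A & inside X e].
Proof.
split=> [[X0 h]|[X0 h]]; split=> //.
  move=> A sA /set0Pn [x xA] nA.
  have [y yX yA] : exists2 y, y \in X & y \notin A.
    by apply/subsetPn; apply: contra nA => s; rewrite eqEsubset sA.
  have /connectP [p pp lp] := h x y (subsetP sA _ xA) yX.
  elim: p x xA pp lp => [|z p IH] x xA /=; first by move=> _ e; rewrite e xA in yA.
  case/andP=> /and3P [xX zX /exists_inP [e eF j]] pp lp.
  have [zA|zA] := boolP (z \in A); first exact: (IH z).
  exists e; rewrite in_cut /inside.
  by case/orP: j => /andP [/eqP -> /eqP ->]; rewrite xA xX zX (negbTE zA).
move=> x y xX yX; pose A := [set z | (z \in X) && connect (adjrel X F) x z].
have [|nA] := eqVneq A X; first by move/setP/(_ y); rewrite !inE yX.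
have [||e [eF /cutP [b [h1 h2]] hi]] := h A _ _ nA.
- by apply/subsetP=> z; rewrite inE => /andP [].
- by apply/set0Pn; exists x; rewrite inE xX connect0.
case/negP: h2; move: hi; rewrite (insideE _ _ b) => /andP [bX nbX].
move: h1; rewrite /A !inE bX nbX /= => hc; apply: connect_trans hc (connect1 _).
rewrite /adjrel /=; apply/and3P; split=> //; apply/exists_inP; exists e => //.
by rewrite /joins; case: (b) => /=; rewrite !eqxx ?orbT.
Qed.

Section Loopless.
Hypothesis ll : loopless G.

Lemma star_end e b : e \in star (gends e b).
Proof.
rewrite (in_cut_end _ _ b) !inE eqxx /=.
by case: b => /=; rewrite ?(negbTE (ll e)) // eq_sym (negbTE (ll e)).
Qed.

Lemma ends_neq e b b' : (gends e b == gends e b') = (b == b').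
Proof.
case: b; case: b'; rewrite ?eqxx // ?(negbTE (ll e)) //.
by rewrite eq_sym (negbTE (ll e)).
Qed.

Lemma in_starE e v b : (e \in star v) = (gends e b == v) || (gends e (~~ b) == v).
Proof.
rewrite (in_cut_end _ _ b) !inE; case: eqP => [<-|] //=.
by rewrite ends_neq; case: b.
Qed.

Lemma ddeg_star F v : ddeg F v = #|F :&: star v|.
Proof.
have hj : {in [set d : gE G * bool | (d.1 \in F) && (gends d.1 d.2 == v)] &,
    injective (fun d : gE G * bool => d.1)}.
  case=> [e b] [e' b']; rewrite !inE /= => /andP [_ /eqP h] /andP [_ /eqP h'] ee.
  by subst e'; move/eqP: h; rewrite -h' ends_neq => /eqP ->.
rewrite /ddeg -(card_in_imset hj); apply: eq_card => e.
apply/imsetP/setIP => [[[e' b]]|[eF /starP [b hb]]].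
  by rewrite inE /= => /andP [eF /eqP <-] ->; rewrite star_end.
by exists (e, b); rewrite // inE /= eF hb eqxx.
Qed.

(** Double counting of incidences: an edge inside [X] is seen from both ends, a cut edge from
    one. *)
Lemma sum_star F X :
  \sum_(v in X) #|F :&: star v| = 2 * #|[set e in F | inside X e]| + #|F :&: cut X|.
Proof.
have h1 v : #|F :&: star v| = \sum_(e in F) (e \in star v).
  by rewrite -sum1_card big_mkcond [RHS]big_mkcond; apply: eq_bigr => e _; rewrite in_setI; case: (e \in F).
rewrite (eq_bigr _ (fun v _ => h1 v)) exchange_big /=.
have h2 e : \sum_(v in X) (e \in star v) = (gends e false \in X) + (gends e true \in X).
  rewrite (eq_bigr (fun v => (gends e false == v) + (gends e true == v))); last first.
    move=> v _; rewrite (in_starE _ _ false) /=; case: eqP => [<-|] //=.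
    by rewrite eq_sym (negbTE (ll e)).
  have h b : \sum_(v in X) (gends e b == v : nat) = (gends e b \in X).
    case: (boolP (gends e b \in X)) => hx.
      rewrite (bigD1 (gends e b)) //= eqxx big1 // => v /andP [_ /negbTE].
      by rewrite eq_sym => ->.
    by rewrite big1 // => v vX; case: eqP => // ev; rewrite ev vX in hx.
  by rewrite big_split /= !h.
rewrite (eq_bigr _ (fun e _ => h2 e)).
rewrite -!sum1_card big_distrr /= [X in _ = X + _](big_mkcond) [X in _ = _ + X](big_mkcond) -big_split /=.
rewrite big_mkcond; apply: eq_bigr => e _; rewrite !inE /inside.
by case: (e \in F); do 2 case: (_ \in X).
Qed.

Lemma odd_cut F X : (forall v, v \in X -> odd #|F :&: star v|) ->
  odd #|F :&: cut X| = odd #|X|.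
Proof.
move=> h; have := sum_star F X => /(congr1 odd); rewrite oddD oddM /= => <-.
rewrite -sum1_card; apply: (big_ind2 (fun s t => odd s = odd t)) => //.
by move=> a b c d; rewrite !oddD => -> ->.
Qed.

End Loopless.

Definition edge_conn2 := forall X, X != set0 -> X != setT -> 1 < #|cut X|.

(** Cubic and 2-connected, expressed by cuts only; [edge_conn2] excludes disconnection and bridges
    at once. This form passes to completions, because their cuts correspond to cuts of the original
    graph. *)
Definition good_graph :=
  [/\ loopless G, forall v, #|star v| = 3, edge_conn2 & 0 < #|gV G|].

(** An end of a bridge is a cut vertex, since it has two further edges. Conversely the three edges
    at a cut vertex are shared between two sides, one of which gets at most one of them. *)
Lemma good_graphP : good_graph <-> cubic G /\ twoconn G.
Proof.
split=> [[ll c3 ec V0]|[c [cn V1 ll cv]]]; last first.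
  have c3 v : #|star v| = 3 by rewrite -(setTI (star v)) -(ddeg_star ll).
  split=> //; last by lia.
  move=> X X0 XT; rewrite ltnNge; apply/negP => h1.
  have h X' : X' != set0 -> X' != setT -> cut X' = cut X -> exists e, e \in cut X'.
    by move=> a b _; case/connect_onP: cn => _ /(_ X' (subsetT _) a b) [e [_ he _]]; exists e.
  have [e he] := h X X0 XT erefl.
  have ce : cut X = [set e].
    by apply/eqP; rewrite eq_sym eqEcard sub1set he cards1.
  have [b [eb neb]] := cutP he.
  have hx : X :\ gends e b != set0.
    apply/negP => /eqP hX; have := cut_del eb; rewrite hX cut0 cards0 c3.
    rewrite (setIidPl _) ?ce ?cards1 // sub1set; exact: star_end.
  have [_] := (connect_onP _ _).1 (cv (gends e b)).
  case/(_ (X :\ gends e b)) => //.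
  - by apply/subsetP=> z; rewrite !inE => /andP [].
  - apply/negP=> /eqP /setP /(_ (gends e (~~ b))).
    by rewrite !inE (negbTE neb) andbF ends_neq //; case: (b).
  - move=> f []; rewrite inE => /forallP nf; rewrite in_cut_del // ce inE.
    case: eqP => [->|_ /=]; first by move: (nf); rewrite star_end.
    by move=> /starP [b' hb']; have := nf b'; rewrite hb' eqxx.
have edge_out (A : {set gV G}) : A != set0 -> A != setT -> exists e, e \in cut A.
  by move=> a b; apply/set0Pn; rewrite -card_gt0; have := ec A a b; lia.
have [v0 _] : exists v0, v0 \in [set: gV G] by apply/set0Pn; rewrite -card_gt0 cardsT.
have V1 : 1 < #|gV G|.
  have [e he] : exists e, e \in star v0 by apply/set0Pn; rewrite -card_gt0 c3.
  by rewrite -(card_bool) -(card_imset predT (f:=gends e)) ?max_card // => a b /eqP; rewrite ends_neq // => /eqP.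
split; first by move=> v; rewrite ddeg_star // setTI.
split=> //.
  apply/connect_onP; split; first by rewrite -card_gt0 cardsT.
  move=> A _ A0 AT; have [e he] := edge_out A A0 AT.
  by exists e; rewrite he /inside !inE.
move=> v; apply/connect_onP; split.
  by rewrite -card_gt0; have := cardsC [set v]; rewrite cards1; lia.
move=> A sA A0 AT; have vA : v \notin A.
  by apply/negP => /(subsetP sA); rewrite !inE eqxx.
have [hA|/subsetPn [e eA ne]] := boolP (cut A \subset star v); last first.
  have nv b : gends e b != v by apply: contra ne => /eqP <-; rewrite star_end.
  exists e; split; rewrite // ?inE; first by apply/forallP=> b; apply: nv.
  by rewrite /inside !inE !nv.
(* Every edge leaving [A] or [B] ends in [v], so the two cuts have three edges together and cannot
   both have two. *)
pose B := ~: (v |: A).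
have B0 : B != set0.
  apply: contra AT => /eqP hB; rewrite eqEsubset sA; apply/subsetP=> x.
  by rewrite !inE => xv; move/setP/(_ x): hB; rewrite !inE (negbTE xv) /= => /negbFE.
have BT : B != setT by apply/negP=> /eqP /setP /(_ v); rewrite !inE eqxx.
have hB : #|cut B| + 2 * #|cut A| = #|cut A| + 3.
  by rewrite cutC -(c3 v) -{1}(setIidPl hA) cut_add.
have := ec _ B0 BT; have := ec A A0; case: eqP => [eA|_ /(_ isT)]; last by lia.
by rewrite eA inE in vA.
Qed.

Section Good.
Hypothesis good : good_graph.

Lemma odd_card_cut X : odd #|cut X| = odd #|X|.
Proof.
case: good => ll c3 _ _; rewrite -(odd_cut ll (F := setT)) ?setTI // => v _.
by rewrite setTI c3.
Qed.

Lemma nontrivial_cut X v w : v \in X -> w \notin X -> 1 < #|cut X|.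
Proof.
case: good => _ _ ec _ vX wX; apply: ec; first by apply/set0Pn; exists v.
by apply: contraNneq wX => ->.
Qed.

Lemma card_gt1_cut X : 1 < #|X| -> 1 < #|~: X| -> 1 < #|cut X|.
Proof.
move=> h1 h2; have /card_gt0P [v vX] : 0 < #|X| by lia.
have /card_gt0P [w] : 0 < #|~: X| by lia.
by rewrite inE => wX; apply: nontrivial_cut vX wX.
Qed.

(** If no edge joined [A] to [X :\: A], the cuts of these two parts would partition [cut X], and
    each of them has at least two edges. *)
Lemma cut_connected X : #|cut X| <= 3 -> X != set0 -> X != setT ->
  connected_on X setT.
Proof.
move=> c3 X0 XT; apply/connect_onP; split=> // A sA A0 AX.
have [/existsP [e /andP [h1 h2]]|no] := boolP [exists e, (e \in cut A) && inside X e].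
  by exists e.
have hA : cut A \subset cut X.
  apply/subsetP=> e eA; have := no; rewrite negb_exists => /forallP /(_ e).
  rewrite eA /=; have [b [h1 h2]] := cutP eA.
  by rewrite (insideE _ _ b) (in_cut_end _ _ b) (subsetP sA _ h1).
have [y yX yA] : exists2 y, y \in X & y \notin A.
  by apply/subsetPn; apply: contra AX => s; rewrite eqEsubset sA.
have [x xA] := set0Pn _ A0.
have [z _ zX] : exists2 z, z \in setT & z \notin X.
  by apply/subsetPn; apply: contra XT => s; rewrite eqEsubset subsetT.
have := card_symdiff (fun e => in_cut_diff e sA); rewrite (setIidPr hA).
have := nontrivial_cut xA yA.
have : 1 < #|cut (X :\: A)|.
  by apply: (@nontrivial_cut _ y x); rewrite !inE ?xA // yA yX.
have := subset_leq_card hA; lia.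
Qed.

Lemma star_le1_independent X :
  (forall w, #|cut X :&: star w| <= 1) -> independent (cut X).
Proof.
case: good => ll _ _ _ h e f eX fX nef b b'; apply/negP=> /eqP he.
have := h (gends e b); rewrite leqNgt => /negP; apply.
apply/card_gt1P; exists e, f; split=> //; rewrite in_setI ?eX ?fX ?star_end //.
by rewrite he star_end.
Qed.

(** If both edges of the cut met at [w], moving [w] to the other side would leave a single cut edge,
    a bridge. *)
Lemma cut2_star_le1 X w : #|cut X| <= 2 -> 1 < #|X| -> 1 < #|~: X| ->
  #|cut X :&: star w| <= 1.
Proof.
case: good => ll c3 _ _ h hX hX'; rewrite leqNgt; apply/negP=> hw.
have [wX|wX] := boolP (w \in X).
  have := cut_del wX; rewrite c3.
  have [x xX] : exists x, x \in X :\ w.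
    by apply/card_gt0P; have := cardsD1 w X; rewrite wX; lia.
  have : 1 < #|cut (X :\ w)|.
    by apply: (nontrivial_cut xX (w := w)); rewrite !inE eqxx.
  lia.
have := cut_add wX; rewrite c3.
have [x] : exists x, x \in ~: X :\ w.
  apply/card_gt0P; have := cardsD1 w (~: X); rewrite in_setC wX; lia.
rewrite !inE => /andP [xw xX]; have : 1 < #|cut (w |: X)|.
  by apply: (@nontrivial_cut _ w x); rewrite !inE ?eqxx // negb_or xw.
lia.
Qed.

Lemma indep_cutI X : #|cut X| <= 3 -> 1 < #|X| -> 1 < #|~: X| ->
  (forall w, #|cut X :&: star w| <= 1) -> indep_cut X.
Proof.
move=> h hX hX' hw; have X0 : X != set0 by rewrite -card_gt0; lia.
have XT : ~: X != set0 by rewrite -card_gt0; lia.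
split; last exact: star_le1_independent.
  by apply: cut_connected => //; apply: contraNneq XT => ->; rewrite setCT.
apply: cut_connected; rewrite ?cutC //.
by apply: contraNneq X0 => hh; rewrite -(setCK X) hh setCT.
Qed.

(** A vertex [w] with two cut edges is moved across, which leaves a 2-cut, and 2-cuts are
    independent. By parity both sides of a 2-cut have an even number of vertices, so neither shrinks
    to one vertex. The last clause records how [Y] can exceed [X], which is needed to keep [Y] off
    the core. *)
Lemma indep_cut_refine X : #|cut X| <= 3 -> 1 < #|X| -> 1 < #|~: X| ->
  exists Y, [/\ indep_cut Y, 1 < #|Y|, 1 < #|~: Y|, #|cut Y| <= 3 &
    Y \subset X \/ exists w, Y = w |: X /\ 1 < #|cut X :&: star w|].
Proof.
case: (good) => ll c3 ec _ h hX hX'.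
have [/forallP hw|] := boolP [forall w, #|cut X :&: star w| <= 1].
  by exists X; split=> //; [apply: indep_cutI|left].
rewrite negb_forall => /existsP [w]; rewrite -ltnNge => hw.
have fin Y : #|cut Y| <= 2 -> 0 < #|Y| -> 0 < #|~: Y| ->
    [/\ indep_cut Y, 1 < #|Y|, 1 < #|~: Y| & #|cut Y| <= 3].
  move=> h2 hY hY'.
  have c2 : #|cut Y| = 2.
    have [y yY] := card_gt0P hY; have [z] := card_gt0P hY'; rewrite inE => zY.
    by have := nontrivial_cut yY zY; lia.
  have e1 : ~~ odd #|Y| by rewrite -odd_card_cut c2.
  have e2 : ~~ odd #|~: Y| by rewrite -odd_card_cut cutC c2.
  have g1 : 1 < #|Y| by lia.
  have g2 : 1 < #|~: Y| by lia.
  split; rewrite ?c2 //; apply: indep_cutI => //; first by lia.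
  by move=> w'; apply: cut2_star_le1.
have [wX|wX] := boolP (w \in X).
  have cd := cut_del wX; rewrite c3 in cd.
  have d1 := cardsD1 w X; rewrite wX in d1.
  have d2 := cardsC (X :\ w); have d3 := cardsC X.
  have [|||g1 g2 g3 g4] := fin (X :\ w); try lia.
  by exists (X :\ w); split=> //; left; apply: subsetDl.
have cd := cut_add wX; rewrite c3 in cd.
have d1 := cardsU1 w X; rewrite wX in d1.
have d2 := cardsC (w |: X); have d3 := cardsC X.
have [|||g1 g2 g3 g4] := fin (w |: X); try lia.
by exists (w |: X); split=> //; right; exists w.
Qed.

Lemma adjrel_sym X F : symmetric (adjrel X F).
Proof.
move=> x y; rewrite /adjrel /= andbCA; congr (_ && (_ && _)).
by apply: eq_existsb => e; rewrite /joins orbC [(_ == y) && _]andbC [(_ == x) && _]andbC.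
Qed.

Lemma circuit_in_component F Z x : circuit Z -> [disjoint Z & F] -> x \in touched Z ->
  1 < #|[set z | connect (adjrel setT (~: F)) x z]|.
Proof.
case: good => ll _ _ _ [Z0 _ [_ cZ]] dZ xZ; have [e eZ] := set0Pn _ Z0.
have h b : gends e b \in [set z | connect (adjrel setT (~: F)) x z].
  have eT : gends e b \in touched Z.
    by rewrite inE; apply/exists_inP; exists e => //; apply/existsP; exists b.
  rewrite inE; apply: connect_sub (cZ _ _ xZ eT) => u v.
  rewrite /adjrel /= => /and3P [_ _ /exists_inP [f fZ j]]; apply: connect1.
  by rewrite /= !inE /=; apply/exists_inP; exists f; rewrite // inE (disjointFr dZ).
by apply/card_gt1P; exists (gends e false), (gends e true); split.
Qed.

(** Two vertices per side can replace circuits, because a circuit in a loopless graph touches at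
    least two vertices. The set reachable from [x] after removing [F] has its cut inside [F]. *)
Lemma cyc_conn4I : (forall X, 1 < #|X| -> 1 < #|~: X| -> 3 < #|cut X|) -> cyc_conn G 4.
Proof.
move=> h; split; first by case: (good_graphP.1 good) => _ [].
move=> F F4 Z1 Z2 cZ1 cZ2 d1 d2 x y xZ yZ; apply: contraLR F4 => nxy.
pose A := [set z | connect (adjrel setT (~: F)) x z].
have sA : cut A \subset F.
  apply/subsetP=> e eA; have [b [h1 h2]] := cutP eA; apply: contraR h2 => eF.
  move: h1; rewrite /A !inE => h1; apply: connect_trans h1 (connect1 _).
  rewrite /adjrel /= !inE /=; apply/exists_inP; exists e; rewrite ?inE //.
  by rewrite /joins; case: (b); rewrite !eqxx ?orbT.
rewrite -leqNgt; apply: leq_trans (subset_leq_card sA); apply: h.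
  exact: circuit_in_component cZ1 d1 xZ.
apply: leq_trans (circuit_in_component cZ2 d2 yZ) (subset_leq_card _).
apply/subsetP=> z; rewrite !inE => yz; apply: contra nxy => xz.
apply: connect_trans xz _.
by rewrite (sym_connect_sym (@adjrel_sym _ _)).
Qed.

Lemma cyc_conn4_or_cut : cyc_conn G 4 \/
  exists X, [/\ 1 < #|X|, 1 < #|~: X| & #|cut X| <= 3].
Proof.
have [/existsP [X /and3P [a b c]]|no] :=
  boolP [exists X : {set gV G}, [&& 1 < #|X|, 1 < #|~: X| & #|cut X| <= 3]].
  by right; exists X.
left; apply: cyc_conn4I => X a b; rewrite ltnNge; apply/negP=> c.
by case/negP: no; apply/existsP; exists X; rewrite a b c.
Qed.

End Good.

End Cuts.

(** * Colourings and 3-arrays *)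

(** The edges of [cut X] are constrained at their end in [X], so a colouring of one side also
    colours the cut; values on edges not meeting [X] are arbitrary. *)
Definition proper_on (G : graph) (X : {set gV G}) (c : gE G -> 'I_3) :=
  forall v, v \in X -> {in star v &, injective c}.

Definition colourable_on (G : graph) (X : {set gV G}) := exists c, @proper_on G X c.

Definition matching_on (G : graph) (X : {set gV G}) (M : {set gE G}) :=
  forall v, v \in X -> #|M :&: star v| = 1.

Lemma ord3_third (i j : 'I_3) : i != j -> exists k, [/\ k != i, k != j &
  forall l, [|| l == i, l == j | l == k]].
Proof.
move=> ij; have h : #|~: [set i; j]| = 1.
  by have := cardsC [set i; j]; rewrite cards2 ij card_ord; lia.
have /card_gt0P [k] : 0 < #|~: [set i; j]| by rewrite h.
rewrite !inE negb_or => /andP [ki kj]; exists k; split=> // l.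
apply: contraPT h; rewrite !negb_or => /and3P [li lj lk] h.
suff : 1 < #|~: [set i; j]| by rewrite h.
by apply/card_gt1P; exists l, k; split; rewrite ?inE ?negb_or ?li ?lj ?ki ?kj.
Qed.

Section Colourings.
Variable G : graph.
Hypothesis good : good_graph G.
Implicit Types (X Y : {set gV G}) (M N : {set gE G}) (e f : gE G) (v w : gV G).

Lemma colourable3P : colourable3 G <-> colourable_on [set: gV G].
Proof.
case: good => ll c3 _ _; split=> [[c h]|[c h]]; exists c.
  move=> v _ e f /starP [b hb] /starP [b' hb'] cef; apply: contraPeq cef => nef.
  apply/eqP; apply: (h (e, b) (f, b')) => /=; first by rewrite hb hb'.
  by apply: contra nef => /eqP [->].
case=> [e b] [f b'] /= hv nd; apply: contra nd => /eqP cef.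
have ef : e = f by apply: (h (gends e b) (in_setT _)) cef; [|rewrite hv]; apply: star_end.
by subst f; move/eqP: hv; rewrite ends_neq // => /eqP ->.
Qed.

Lemma matching_uniq X M v e f : matching_on X M -> v \in X ->
  e \in M -> f \in M -> e \in star v -> f \in star v -> e = f.
Proof.
move=> h vX eM fM ev fv; have /eqP/cards1P [g hg] := h v vX.
have : e \in M :&: star v by rewrite in_setI eM.
have : f \in M :&: star v by rewrite in_setI fM.
by rewrite hg !in_set1 => /eqP -> /eqP ->.
Qed.

Lemma matching_edge X M v : matching_on X M -> v \in X ->
  exists2 e, e \in M & e \in star v.
Proof.
move=> h vX; have /card_gt0P [e] : 0 < #|M :&: star v| by rewrite h.
by rewrite in_setI => /andP [eM ev]; exists e.
Qed.

Lemma star_card4 v (a b c d : gE G) : uniq [:: a; b; c; d] ->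
  [&& a \in star v, b \in star v, c \in star v & d \in star v] -> False.
Proof.
case: good => _ c3 _ _ u /and4P [ha hb hc hd].
have : #|[set:: [:: a; b; c; d]]| <= #|star v|.
  by apply/subset_leq_card/subsetP=> x; rewrite !inE => /or4P [] /eqP ->; move: ha hb hc hd; rewrite !inE.
by rewrite c3 cardsE (card_uniqP u).
Qed.

Lemma star_third v e f : e \in star v -> f \in star v -> e != f ->
  exists g, [/\ g \in star v, g != e, g != f &
    forall x, x \in star v -> [|| x == e, x == f | x == g]].
Proof.
case: (good) => _ c3 _ _ ev fv nef.
have /card_gt0P [g] : 0 < #|star v :\: [set e; f]|.
  have := cardsID [set e; f] (star v); rewrite c3.
  by have := subset_leq_card (subsetIr (star v) [set e; f]); rewrite cards2 nef; lia.
rewrite in_setD in_set2 negb_or => /andP [/andP [ge gf] gv].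
exists g; split=> // x xv; apply/negPn/negP; rewrite !negb_or => /and3P [xe xf xg].
apply: (@star_card4 v x e f g); last by rewrite xv ev fv gv.
by rewrite /= !inE !negb_or xe xf xg nef ![_ == g]eq_sym ge gf.
Qed.

(** The edges outside both matchings form the third colour class: at each vertex exactly one edge
    remains. *)
Lemma colourable_on_matchings X M N : matching_on X M -> matching_on X N ->
  (forall v e, v \in X -> e \in star v -> e \in M -> e \notin N) -> colourable_on X.
Proof.
move=> hM hN hd; exists (fun e => if e \in M then inord 0 else if e \in N then inord 1 else inord 2).
move=> v vX e f ev fv.
have n01 : (inord 0 == inord 1 :> 'I_3) = false by rewrite -val_eqE /= !inordK.
have n02 : (inord 0 == inord 2 :> 'I_3) = false by rewrite -val_eqE /= !inordK.
have n12 : (inord 1 == inord 2 :> 'I_3) = false by rewrite -val_eqE /= !inordK.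
case: (boolP (e \in M)) => eM; case: (boolP (f \in M)) => fM.
- by move=> _; apply: matching_uniq hM vX eM fM ev fv.
- by case: ifP => _ /eqP; rewrite ?n01 ?n02.
- by case: ifP => _ /eqP; rewrite eq_sym ?n01 ?n02.
case: (boolP (e \in N)) => eN; case: (boolP (f \in N)) => fN.
- by move=> _; apply: matching_uniq hN vX eN fN ev fv.
- by move/eqP; rewrite n12.
- by move/eqP; rewrite eq_sym n12.
move=> _; apply/eqP/negPn/negP => nef.
have [a aM av] := matching_edge hM vX; have [b bN bv] := matching_edge hN vX.
apply: (@star_card4 v a b e f); rewrite ?av ?bv ?ev ?fv //.
have nab : a != b by apply: contraTneq bN => <-; apply: hd vX av aM.
have nx x : x \notin M -> x \notin N -> (a != x) && (b != x).
  by move=> xM xN; apply/andP; split; [apply: contraTneq aM => ->|apply: contraTneq bN => ->].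
have /andP [ae be] := nx e eM eN; have /andP [af bf] := nx f fM fN.
by rewrite /= !inE !negb_or nab ae af be bf nef.
Qed.

Lemma proper_class X c (i : 'I_3) : proper_on X c ->
  matching_on X [set e | c e == i].
Proof.
case: (good) => _ c3 _ _ h v vX; have := h v vX => inj.
have sT : c @: star v = [set: 'I_3].
  by apply/eqP; rewrite eqEcard subsetT cardsT card_ord card_in_imset // c3.
have : i \in c @: star v by rewrite sT inE.
case/imsetP=> e ev ie; apply/eqP/cards1P; exists e; apply/setP=> f.
rewrite in_setI in_set1 inE ie; apply/andP/eqP => [[/eqP cf fv]|->]; last by [].
exact: inj.
Qed.

Lemma odd_matching_cut X M : matching_on X M -> odd #|M :&: cut X| = odd #|X|.
Proof. by case: good => ll _ _ _ h; apply: odd_cut => // v vX; rewrite h. Qed.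

(** Each colour class is a matching on [X], hence meets the cut in an odd number of edges. Three
    classes share three edges, so each takes one. *)
Lemma proper_cut3 X c : proper_on X c -> #|cut X| = 3 -> {in cut X &, injective c}.
Proof.
move=> h h3 e f eX fX cef; apply/eqP/negPn/negP => nef.
have odd_class i : 0 < #|[set e | c e == i] :&: cut X|.
  by have := odd_matching_cut (proper_class i h); rewrite -(odd_card_cut good) h3; case: #|_|.
have /card_gt0P [j] : 0 < #|~: [set c e]| by rewrite cardsC1 card_ord.
rewrite !inE => hj.
have [k [k1 k2 _]] := ord3_third hj.
have [a] := card_gt0P (odd_class j); rewrite in_setI inE => /andP [ha aX].
have [b] := card_gt0P (odd_class k); rewrite in_setI inE => /andP [hb bX].
suff : 3 < #|cut X| by rewrite h3.
have u : uniq [:: e; f; a; b].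
  have ea : e != a by apply: contraNneq hj => ->; rewrite (eqP ha).
  have fa : f != a by apply: contraNneq hj => fa; rewrite cef fa (eqP ha).
  have eb : e != b by apply: contraNneq k2 => ->; rewrite (eqP hb).
  have fb : f != b by apply: contraNneq k2 => fb; rewrite cef fb (eqP hb).
  have ab : a != b by apply: contraNneq k1 => ab; rewrite -(eqP hb) -ab (eqP ha).
  by rewrite /= !inE !negb_or nef ea eb fa fb ab.
have sub : all (mem (cut X)) [:: e; f; a; b] by rewrite /= eX fX aX bX.
by rewrite -[4]/(size [:: e; f; a; b]) -(card_uniqP u); apply/subset_leq_card/subsetP=> x /(allP sub).
Qed.

Lemma proper_cut2 X c e f : proper_on X c -> #|cut X| = 2 ->
  e \in cut X -> f \in cut X -> c e = c f.
Proof.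
move=> h h2 eX fX; apply/eqP/negPn/negP => ncef.
have nef : e != f by apply: contra ncef => /eqP ->.
have cX : cut X = [set e; f].
  by apply/eqP; rewrite eq_sym eqEcard h2 cards2 nef subUset !sub1set eX fX.
have := odd_matching_cut (proper_class (c e) h); rewrite -(odd_card_cut good) h2.
have -> : [set e0 | c e0 == c e] :&: cut X = [set e]; last by rewrite cards1.
apply/setP=> x; rewrite cX !inE; case: (eqVneq x e) => [->|_] /=; first by rewrite eqxx.
by case: (eqVneq x f) => [->|_]; rewrite ?andbF //= andbT eq_sym (negbTE ncef).
Qed.

(* By parity the colours on a small cut are all equal (2 edges) or all distinct
   (3 edges), so the colours of one side can be permuted to match the other. *)
Lemma recolour_cut X c c' : #|cut X| <= 3 -> proper_on (~: X) c' ->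
  proper_on X c \/ (#|cut X| = 3 /\ {in cut X &, injective c}) ->
  exists2 s : 'I_3 -> 'I_3, injective s & forall e, e \in cut X -> s (c' e) = c e.
Proof.
move=> h3 hc' hc.
have [c0|[e0 e0X]] := set_0Vmem (cut X).
  by exists id => // e; rewrite c0 inE.
have h1 : 1 < #|cut X|.
  by have [b [b1 b2]] := cutP e0X; apply: nontrivial_cut b1 b2.
have [c3|c2] : #|cut X| = 3 \/ #|cut X| = 2 by lia.
  have i1 : {in cut X &, injective c} by case: hc => [hc|[]//]; exact: proper_cut3.
  have i2 : {in cut (~: X) &, injective c'} by apply: proper_cut3; rewrite ?cutC.
  have ex i : exists e, (e \in cut X) && (c' e == i).
    have : i \in c' @: cut X.
      suff -> : c' @: cut X = setT by rewrite inE.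
      apply/eqP; rewrite eqEcard subsetT cardsT card_ord card_in_imset ?c3 //.
      by move: i2; rewrite cutC.
    by case/imsetP => e eX ->; exists e; rewrite eX eqxx.
  exists (fun i => c (xchoose (ex i))).
    move=> i j; have /andP [a1 /eqP a2] := xchooseP (ex i).
    have /andP [b1 /eqP b2] := xchooseP (ex j).
    by move/(i1 _ _ a1 b1) => hh; rewrite -a2 -b2 hh.
  move=> e eX; have /andP [a1 /eqP a2] := xchooseP (ex (c' e)).
  by congr c; apply: i2; rewrite ?cutC.
case: hc => [hc|[c3 _]]; last by rewrite c3 in c2.
exists (tperm (c' e0) (c e0)); first exact: perm_inj.
move=> e eX; rewrite (proper_cut2 hc c2 eX e0X).
by rewrite (@proper_cut2 (~: X) c' e e0) ?cutC // tpermL.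
Qed.

(** [Y] may be the whole complement of [X], where parity controls the colours on the cut, or only a
    part of it, where distinct colours on the cut have to be supplied. The second case serves when a
    further triangle is still uncoloured. Only edges inside [X] are recoloured, so [c] survives on
    the cut. *)
Lemma proper_extend X Y c : #|cut X| <= 3 -> [disjoint X & Y] ->
  proper_on Y c -> colourable_on X ->
  Y = ~: X \/ (#|cut X| = 3 /\ {in cut X &, injective c}) -> colourable_on (X :|: Y).
Proof.
move=> h3 dXY hc [c' hc'] hY.
have [s sI hs] : exists2 s : 'I_3 -> 'I_3, injective s &
    forall e, e \in cut X -> s (c' e) = c e.
  rewrite -[cut X]cutC; apply: recolour_cut; rewrite ?cutC ?setCK //.
  by case: hY => [<-|]; [left|right].
exists (fun e => if inside X e then s (c' e) else c e).
have hX v e : v \in X -> e \in star v ->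
    (if inside X e then s (c' e) else c e) = s (c' e).
  move=> vX /starP [b hb]; case: ifP => //; rewrite (insideE _ _ b) hb vX /= => h.
  by rewrite hs // (in_cut_end _ _ b) hb vX h.
have hX' v e : v \notin X -> e \in star v ->
    (if inside X e then s (c' e) else c e) = c e.
  by move=> vX /starP [b hb]; rewrite (insideE _ _ b) hb (negbTE vX).
move=> v; rewrite in_setU; case: (boolP (v \in X)) => vX /= vY e f ev fv.
  by rewrite (hX v e vX ev) (hX v f vX fv) => /sI; apply: (hc' v vX).
by rewrite (hX' v e vX ev) (hX' v f vX fv); apply: (hc v vY).
Qed.

Lemma colourable_glue X : #|cut X| <= 3 -> colourable_on X -> colourable_on (~: X) ->
  colourable3 G.
Proof.
move=> h3 cX [c hc]; apply/colourable3P; rewrite -(setUCr X).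
apply: (proper_extend h3 _ hc cX); last by left.
by rewrite -setI_eq0 setICr.
Qed.

(** Since [p] is parallel to [f], replacing [f] by [p] keeps [M] a perfect matching, and it removes
    the only edge shared with [N]. *)
Lemma colourable_swap M N f p : matching_on setT M -> matching_on setT N ->
  M :&: N = [set f] -> p \notin N -> p != f ->
  (forall v, (p \in star v) = (f \in star v)) -> colourable3 G.
Proof.
move=> hM hN hMN pN pf par; apply/colourable3P.
have /setIP [fM fN] : f \in M :&: N by rewrite hMN set11.
have pM : p \notin M.
  apply: contra pf => pM; case: (good) => ll _ _ _; have sf := star_end ll f false.
  by apply/eqP; apply: (matching_uniq hM (v := gends f false)); rewrite ?in_setT ?par.
apply: (@colourable_on_matchings setT (p |: M :\ f) N) => //.
  move=> v vT; rewrite -(hM v vT); case: (boolP (f \in star v)) => fv.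
    have pv : p \in star v by rewrite par.
    have -> : (p |: M :\ f) :&: star v = p |: ((M :&: star v) :\ f).
      apply/setP=> x; rewrite !(in_setU, in_setI, in_setD, in_set1).
      by case: eqP => [->|_]; rewrite ?pv // andbA.
    rewrite cardsU1 (cardsD1 f (M :&: star v)) !(in_setD, in_setI, in_set1) fM fv.
    by rewrite (negbTE pM) /= andbF.
  congr #|pred_of_set _|; apply/setP=> x; rewrite !(in_setU, in_setI, in_setD, in_set1).
  case: (eqVneq x p) => [->|_] /=; first by rewrite par (negbTE fv) andbF.
  by case: (eqVneq x f) => [->|_] //=; rewrite (negbTE fv) andbF.
move=> v e _ _; rewrite !(in_setU, in_setD, in_set1) => /orP [/eqP -> //|/andP [ef eM]].
apply/negP=> eN; have : e \in M :&: N by rewrite in_setI eM.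
by rewrite hMN in_set1 (negbTE ef).
Qed.

End Colourings.

(** * Triples of perfect matchings in an uncolourable graph *)

Definition array (G : graph) (m : 'I_3 -> {set gE G}) :=
  forall i, matching_on setT (m i).

Definition mult (G : graph) (m : 'I_3 -> {set gE G}) e := #|[set i | e \in m i]|.

Definition misses (G : graph) (m : 'I_3 -> {set gE G}) := [set e | mult m e == 0].

(* In an optimal array of defect 3 no edge lies in all three matchings, and
   [D i] is the only edge outside [m i] that lies in both other matchings. *)
Record skeleton (G : graph) (m : 'I_3 -> {set gE G}) (D : 'I_3 -> gE G) := Skeleton {
  sk_array : array m;
  sk_misses : #|misses m| <= 3;
  sk_mem : forall i j, (D i \in m j) = (j != i);
  sk_uniq : forall e i j k, i != j -> j != k -> k != i ->
    e \in m i -> e \in m j -> e = D k }.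

Section Arrays.
Variable G : graph.
Hypothesis good : good_graph G.
Implicit Types (X Y : {set gV G}) (M N : {set gE G}) (e f : gE G) (v w : gV G).
Variable m : 'I_3 -> {set gE G}.

Lemma mem_misses e : (e \in misses m) = [forall i, e \notin m i].
Proof.
rewrite inE /mult cards_eq0; apply/eqP/forallP => [h i|h].
  by have := in_set0 i; rewrite -h inE => ->.
by apply/setP=> i; rewrite !inE (negbTE (h i)).
Qed.

Lemma mult1P e : reflect (exists2 i, e \in m i & forall j, e \in m j -> j = i) (mult m e == 1).
Proof.
apply: (iffP cards1P) => [[i hi]|[i ei hi]]; exists i.
    by have := set11 i; rewrite -hi inE.
  by move=> j ej; apply/set1P; rewrite -hi inE.
by apply/setP=> j; rewrite !inE; apply/idP/eqP => [/hi|->].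
Qed.

Hypothesis arr : array m.

Lemma card_matching M : matching_on setT M -> 2 * #|M| = #|gV G|.
Proof.
case: good => ll _ _ _ h; have := sum_star ll M setT.
rewrite cutT setI0 cards0 addn0 (eq_bigr (fun=> 1)); last by move=> v vT; rewrite h.
rewrite sum1_card cardsT => ->; congr (2 * #|pred_of_set _|).
by apply/setP=> e; rewrite in_set /inside !in_setT /= andbT.
Qed.

Lemma card_edges : 2 * #|gE G| = 3 * #|gV G|.
Proof.
case: good => ll c3 _ _; have := sum_star ll setT setT.
rewrite cutT setI0 cards0 addn0 (eq_bigr (fun=> 3)); last by move=> v vT; rewrite setTI c3.
rewrite sum_nat_const cardsT mulnC => ->; congr (2 * _); rewrite -cardsT.
by congr #|pred_of_set _|; apply/setP=> e; rewrite inE /inside !inE.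
Qed.

(** Inclusion-exclusion for the union of the three matchings. The linear terms cancel because three
    perfect matchings have together as many edges as the cubic graph. *)
Lemma misses_count i j k : i != j -> j != k -> k != i ->
  #|misses m| + #|m i :&: m j :&: m k| =
  #|m i :&: m j| + #|m j :&: m k| + #|m k :&: m i|.
Proof.
move=> ij jk ki.
have all3 l : [|| l == i, l == j | l == k].
  have [k' [k'i k'j h]] := ord3_third ij.
  by have := h k; rewrite (negbTE ki) eq_sym (negbTE jk) /= => /eqP ->; apply: h.
have mU : misses m = ~: (m i :|: m j :|: m k).
  apply/setP=> e; rewrite mem_misses !inE; apply/forallP/idP => [h|].
    by rewrite !negb_or !h.
  by rewrite !negb_or => /andP [/andP [a b] c] l; case/or3P: (all3 l) => /eqP ->.
have cT := cardsC (m i :|: m j :|: m k); rewrite -mU in cT.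
have := cardsUI (m i :|: m j) (m k); have := cardsUI (m i) (m j).
rewrite setIUl; have := cardsUI (m i :&: m k) (m j :&: m k).
have -> : m i :&: m k :&: (m j :&: m k) = m i :&: m j :&: m k.
  by rewrite setIACA setIid.
rewrite [m k :&: m i]setIC.
have := card_matching (arr i); have := card_matching (arr j); have := card_matching (arr k).
have := card_edges.
by move: cT; lia.
Qed.

Hypothesis ncol : ~ colourable3 G.

Lemma pair_meets i j : i != j -> 0 < #|m i :&: m j|.
Proof.
move=> ij; rewrite lt0n; apply/negP => /eqP h0; apply: ncol; apply/(colourable3P good).
apply: (colourable_on_matchings good (arr i) (arr j)) => v e _ _ ei.
by apply/negP=> ej; have := in_set0 e; rewrite -(cards0_eq h0) in_setI ei ej.
Qed.

(* A triple edge [e] forces a parallel uncovered edge, and some pair of matchings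
   meets in [e] only: exchanging the two edges makes that pair disjoint. *)
Lemma no_triple i j k e : i != j -> j != k -> k != i -> #|misses m| <= 3 ->
  e \in m i -> e \in m j -> e \in m k -> False.
Proof.
case: (good) => ll c3 _ _ ij jk ki h3 ei ej ek.
have cnt := misses_count ij jk ki; set t := #|m i :&: m j :&: m k| in cnt.
have et : 0 < t by apply/card_gt0P; exists e; rewrite !in_setI ei ej ek.
have all3 l : [|| l == i, l == j | l == k].
  have [k' [k'i k'j h]] := ord3_third ij.
  by have := h k; rewrite (negbTE ki) eq_sym (negbTE jk) /= => /eqP ->; apply: h.
have nomiss v f : e \in star v -> f \in star v -> f != e -> f \in misses m.
  move=> ev fv fe; rewrite mem_misses; apply/forallP=> l; apply: contra fe => fl.
  apply/eqP; apply: (matching_uniq (arr l) (in_setT v)) => //.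
  by case/or3P: (all3 l) => /eqP ->.
(* The two other edges at each end of [e] are uncovered. At most three edges are uncovered, so the
   two pairs share an edge, which is parallel to [e]. *)
have [p [pe pm par]] : exists p, [/\ p != e, p \in misses m &
    forall v, (p \in star v) = (e \in star v)].
  have ev b : e \in star (gends e b) by apply: star_end.
  have two b : 1 < #|star (gends e b) :\ e|.
    by have := cardsD1 e (star (gends e b)); rewrite ev c3; lia.
  have [/eqP|[p]] := set_0Vmem ((star (gends e false) :\ e) :&: (star (gends e true) :\ e)).
    rewrite -cards_eq0 => /eqP d0.
    have := cardsUI (star (gends e false) :\ e) (star (gends e true) :\ e).
    have : #|(star (gends e false) :\ e) :|: (star (gends e true) :\ e)| <= #|misses m|.
      apply/subset_leq_card/subsetP=> f; rewrite in_setU !in_setD1.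
      by case/orP=> /andP [fe fv]; apply: nomiss fv fe.
    by have := two false; have := two true; lia.
  rewrite in_setI !in_setD1 => /andP [/andP [pe p1] /andP [_ p2]].
  exists p; split=> //; first exact: nomiss p1 pe.
  have [b1 hb1] := starP p1; have [b2 hb2] := starP p2.
  have b12 : b2 = ~~ b1.
    have : gends p b1 != gends p b2 by rewrite hb1 hb2.
    by rewrite ends_neq //; case: b1 {hb1}; case: b2 {hb2}.
  move=> v; rewrite (in_starE ll p v b1) -b12 hb1 hb2.
  by rewrite (in_starE ll e v false).
have fin a b c : a != b -> b != c -> c != a -> e \in m a -> e \in m b ->
    #|m a :&: m b| <= 1 -> False.
  move=> ab bc ca ea eb le1; apply: ncol.
  have he : m a :&: m b = [set e].
    by apply/eqP; rewrite eq_sym eqEcard sub1set in_setI ea eb cards1.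
  apply: (colourable_swap good (arr a) (arr b) he) pe par.
  by move: pm; rewrite mem_misses => /forallP.
have s1 : t <= #|m i :&: m j| by apply/subset_leq_card/subsetIl.
have s2 : t <= #|m j :&: m k|.
  by apply/subset_leq_card/subsetP=> x; rewrite !inE => /andP [/andP [_ ->] ->].
have s3 : t <= #|m k :&: m i|.
  by apply/subset_leq_card/subsetP=> x; rewrite !inE => /andP [/andP [-> _] ->].
(* If every pair met in two or more edges, [cnt] would give [6 <= 3 + t], so [t >= 3]; but each pair
   has at least [t] edges, so also [3 * t <= 3 + t]. *)
have [l1|g1] := leqP #|m i :&: m j| 1; first exact: fin ij jk ki ei ej l1.
have [l2|g2] := leqP #|m j :&: m k| 1; first exact: fin jk ki ij ej ek l2.
have [l3|g3] := leqP #|m k :&: m i| 1; first exact: fin ki ij jk ek ei l3.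
lia.
Qed.

(** Without triple edges the number of misses is the sum of the three pairwise intersections. Each
    is at least one and the sum is at most three, so all are singletons. The equality with three
    also provides the lower bound on the defect. *)
Lemma skeletonI : #|misses m| <= 3 -> #|misses m| = 3 /\ exists D, skeleton m D.
Proof.
move=> h3.
have exD i : exists e, [forall j, (e \in m j) == (j != i)].
  have /card_gt0P [j] : 0 < #|~: [set i]| by rewrite cardsC1 card_ord.
  rewrite !inE => ji; have [k [kj ki all]] := ord3_third ji.
  have jk : j != k by rewrite eq_sym.
  have := pair_meets jk; case/card_gt0P=> e /setIP [ej ek].
  exists e; apply/forallP=> l; apply/eqP.
  case/or3P: (all l) => /eqP ->; rewrite ?ji ?ki ?eqxx ?ej ?ek //.
  apply/negP=> ei; apply: (no_triple jk ki _ h3 ej ek ei); by rewrite eq_sym.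
have DE i j : (xchoose (exD i) \in m j) = (j != i).
  by have /forallP /(_ j) /eqP := xchooseP (exD i).
have gt i j k : i != j -> j != k -> k != i ->
   #|misses m| = 3 /\ m i :&: m j = [set xchoose (exD k)].
  move=> ij jk ki; have := misses_count ij jk ki.
  have -> : m i :&: m j :&: m k = set0.
    apply/setP=> e; rewrite !inE; apply/negP=> /andP [/andP [ei ej] ek].
    exact: (no_triple ij jk ki h3 ei ej ek).
  rewrite cards0 addn0 => cnt.
  have := pair_meets ij; have := pair_meets jk; have := pair_meets ki => g1 g2 g3.
  have c1 : #|m i :&: m j| = 1 by lia.
  split; first by lia.
  apply/esym/eqP; rewrite eqEcard sub1set in_setI !DE cards1 c1 leqnn andbT.
  by rewrite [i == k]eq_sym ki jk.
split.
  have n01 : (ord0 : 'I_3) != ord_max by [].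
  have [k [k0 kM _]] := ord3_third n01.
  by have [] := gt _ _ _ n01 (etrans (congr1 _ (eq_sym _ _)) kM) k0.
exists (fun i => xchoose (exD i)); split=> // e i j k ij jk ki ei ej.
have [_ hh] := gt i j k ij jk ki; apply/set1P; rewrite -hh in_setI ei ej //.
Qed.

End Arrays.

(** * Local structure of the core at the edges [D i] *)

Section Skeletons.
Variable G : graph.
Hypothesis good : good_graph G.
Implicit Types (X Y : {set gV G}) (e f : gE G) (v w : gV G).
Variables (m : 'I_3 -> {set gE G}) (D : 'I_3 -> gE G).
Hypothesis sk : skeleton m D.

Lemma skeleton_inj i j : D i = D j -> i = j.
Proof.
move=> h; have := sk_mem sk j i; rewrite -h (sk_mem sk) eqxx /=.
by move/esym/eqP.
Qed.

(** Any two of the edges [D i] lie together in the third matching, hence they are not adjacent. *)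
Lemma skeleton_uniq2 v i j : D i \in star v -> D j \in star v -> i = j.
Proof.
move=> hi hj; apply/eqP/negPn/negP=> ij; have [k [ki kj _]] := ord3_third ij.
case/eqP: ij; apply: skeleton_inj.
by apply: (matching_uniq (sk_array sk k) (in_setT v)); rewrite ?(sk_mem sk).
Qed.

(** At such a vertex no edge is in two matchings, so the three matchings select its three edges, one
    each. *)
Lemma off_skeleton v e : (forall i, D i \notin star v) -> e \in star v -> mult m e = 1.
Proof.
case: good => _ c3 _ _ no ev.
have ex i : exists f, (f \in m i) && (f \in star v).
  by have [f f1 f2] := matching_edge (sk_array sk i) (in_setT v); exists f; rewrite f1.
have xI i : (xchoose (ex i) \in m i) /\ (xchoose (ex i) \in star v).
  by apply/andP; exact: (xchooseP (ex i)).
have dis i j f : f \in star v -> f \in m i -> f \in m j -> j = i.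
  move=> fv fi fj; apply/eqP/negPn/negP=> ij; have [k [kj ki _]] := ord3_third ij.
  have ik : i != k by rewrite eq_sym.
  have := no k; rewrite -(sk_uniq sk ij ik kj fj fi) fv //.
have inj : injective (fun i => xchoose (ex i)).
  move=> i j h; have [a1 a2] := xI i; have [b1 b2] := xI j.
  by apply: dis a2 _ a1; rewrite h.
have im : [set xchoose (ex i) | i in [set: 'I_3]] = star v.
  apply/eqP; rewrite eqEcard c3 card_imset // cardsT card_ord leqnn andbT.
  by apply/subsetP=> _ /imsetP [i _ ->]; case: (xI i).
move: (ev); rewrite -im => /imsetP [i _ ei]; apply/eqP/mult1P.
exists i; first by rewrite ei; case: (xI i).
by move=> j ej; apply: dis ev _ ej; rewrite ei; case: (xI i).
Qed.

(** At an end of [D i] the two other matchings use [D i] itself, [m i] uses a second edge [g], and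
    nothing is left for the third edge [u]. So the core passes through this vertex along [D i] and
    [u]. *)
Lemma at_skeleton v i : D i \in star v -> exists u g,
  [/\ [/\ u \in star v, g \in star v & u \in misses m],
      [/\ g \in m i, u != D i & g != D i], u != g &
      forall e, e \in star v -> [|| e == D i, e == u | e == g]].
Proof.
move=> Dv; have [g gi gv] := matching_edge (sk_array sk i) (in_setT v).
have gD : g != D i by apply: contraTneq gi => ->; rewrite (sk_mem sk) eqxx.
have Dg : D i != g by rewrite eq_sym.
have [u [uv uD ug all]] := star_third good Dv gv Dg.
exists u, g; split=> //; last first.
  by move=> e /all; rewrite [(e == g) || _]orbC.
split=> //; rewrite mem_misses; apply/forallP=> j; have [->|ji] := eqVneq j i.
  apply: contra ug => ui; apply/eqP.
  exact: (matching_uniq (sk_array sk i) (in_setT v)).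
apply: contra uD => uj; apply/eqP.
by apply: (matching_uniq (sk_array sk j) (in_setT v)); rewrite ?(sk_mem sk).
Qed.

Lemma misses_skeleton u v : u \in misses m -> u \in star v -> exists i, D i \in star v.
Proof.
move=> um uv; apply/existsP; apply: contraLR um; rewrite negb_exists => /forallP no.
by rewrite inE (off_skeleton no uv).
Qed.

Lemma mult_skeleton i : mult m (D i) = 2.
Proof.
rewrite /mult; have -> : [set j | D i \in m j] = ~: [set i].
  by apply/setP=> j; rewrite !inE (sk_mem sk).
by rewrite cardsC1 card_ord.
Qed.

(** The two matchings other than [m i] share only [D i], so on [X] they are disjoint. *)
Lemma colourable_on_skeleton X i :
  (forall v, v \in X -> D i \notin star v) -> colourable_on X.
Proof.
move=> no; have /card_gt0P [j] : 0 < #|~: [set i]| by rewrite cardsC1 card_ord.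
rewrite !inE => ji; have [k [kj ki _]] := ord3_third ji.
have jk : j != k by rewrite eq_sym.
have ik : i != k by rewrite eq_sym.
have onX l : matching_on X (m l) by move=> v _; apply: (sk_array sk l); rewrite inE.
apply: (colourable_on_matchings good (onX j) (onX k)) => v e vX ev ej.
by apply/negP=> ek; have := no v vX; rewrite -(sk_uniq sk jk ki _ ej ek) ?ev // eq_sym.
Qed.

End Skeletons.

(** * Small cuts and the core *)

(** It is enough to mention the edges [D i]: at a vertex that meets none of them every edge is
    simply covered, so the core does not touch it. *)
Definition core_free (G : graph) (D : 'I_3 -> gE G) (X : {set gV G}) :=
  forall v i, v \in X -> D i \notin star v.

(* Conditions satisfied by a triangle [Z] that meets the core: two of the three edges [D j]
   leave [Z], and the third edge of [cut Z] lies in [m i] too. *)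
Record triangle_side (G : graph) (m : 'I_3 -> {set gE G}) (D : 'I_3 -> gE G)
    (Z : {set gV G}) (i : 'I_3) := TriangleSide {
  ts_card : #|Z| = 3;
  ts_star : forall z, z \in Z -> #|cut Z :&: star z| = 1;
  ts_mem : forall j, (D j \in cut Z) = (j != i);
  ts_sub : cut Z \subset m i;
  ts_out : forall v, v \in Z -> D i \notin star v }.

Section Sides.
Variable G : graph.
Hypothesis good : good_graph G.
Hypothesis ncol : ~ colourable3 G.
Implicit Types (X Y Z : {set gV G}) (e f : gE G) (v w : gV G).
Variables (m : 'I_3 -> {set gE G}) (D : 'I_3 -> gE G).
Hypothesis sk : skeleton m D.

Lemma cut_one_end Z e v w : e \in cut Z -> v \in Z -> w \in Z ->
  e \in star v -> e \in star w -> v = w.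
Proof.
move=> eZ vZ wZ /starP [b hb] /starP [b' hb'].
case: (eqVneq b b') => [bb|nb]; first by rewrite -hb -hb' bb.
have nbb : b' = ~~ b by move: nb; case: (b); case: (b').
by move: eZ; rewrite (in_cut_end _ _ b) -nbb hb hb' vZ wZ.
Qed.

Lemma side_exists X : #|cut X| <= 3 -> exists Z,
  [/\ Z = X \/ Z = ~: X, colourable_on Z,
      (forall i v, v \in Z -> D i \in star v -> D i \in cut Z) &
      exists i, forall v, v \in Z -> D i \notin star v].
Proof.
(* If all three edges [D i] were in the cut they would be the whole cut, and [m ord0] would meet a
   cut of three edges in exactly two, against parity. *)
move=> h3; have [i iX] : exists i, D i \notin cut X.
  apply/existsP; rewrite -negb_forall; apply/negP => /forallP all.
  have Dinj := skeleton_inj sk.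
  have c3 : D @: setT = cut X.
    apply/eqP; rewrite eqEcard card_imset // cardsT card_ord h3 andbT.
    by apply/subsetP=> _ /imsetP [i _ ->].
  have arr0 : matching_on X (m ord0) by move=> v _; apply: (sk_array sk); rewrite inE.
  have := odd_matching_cut good arr0; rewrite -(odd_card_cut good).
  have -> : m ord0 :&: cut X = D @: [set~ ord0].
    rewrite -c3; apply/setP=> e; rewrite in_setI; apply/andP/imsetP.
      case=> e0 /imsetP [i _ ei]; exists i => //; rewrite !inE eq_sym.
      by rewrite -(sk_mem sk) -ei.
    case=> i; rewrite !inE => i0 ->; rewrite (sk_mem sk) eq_sym i0; split=> //.
    exact: imset_f.
  by rewrite -c3 !card_imset // cardsC1 cardsT card_ord.
have out Y j : D j \notin cut Y -> gends (D j) false \in Y ->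
    forall v, v \in ~: Y -> D j \notin star v.
  move=> jY f v vY; apply/negP=> /starP [b hb]; rewrite inE -hb in vY.
  case: b {hb} vY; rewrite ?f // => vY.
  by move: jY; rewrite in_cut f (negbTE vY).
have [Z [ZX noZ]] : exists Z, (Z = X \/ Z = ~: X) /\ forall v, v \in Z -> D i \notin star v.
  have [iX'|iX'] := boolP (gends (D i) false \in X).
    by exists (~: X); split; [right|apply: out].
  exists X; split; first by left.
  by have := out (~: X) i; rewrite cutC setCK in_setC; apply.
exists Z; split=> //; last by exists i.
  exact: (colourable_on_skeleton good sk noZ).
(* Otherwise [D j] lies inside [Z], so the opposite side is coloured by the matchings other than
   [m j] and can be glued to [Z]. *)
move=> j v vZ jv; apply/negPn/negP=> jZ; apply: ncol.
apply: (colourable_glue good (X := Z)).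
- by case: ZX => ->; rewrite ?cutC.
- exact: (colourable_on_skeleton good sk noZ).
- apply: (colourable_on_skeleton good sk (i := j)); apply: out => //.
  case/starP: jv => b hb; rewrite -hb in vZ; case: b {hb} vZ => // vZ.
  by move: jZ; rewrite in_cut vZ; case: (_ \in Z).
Qed.

Section Side.
Variables (Z : {set gV G}) (i j k : 'I_3).
Hypothesis (Zle3 : #|cut Z| <= 3) (ij : i != j) (jk : j != k) (ki : k != i).
Hypothesis all3 : forall l, [|| l == i, l == j | l == k].
Hypothesis onZ : forall l v, v \in Z -> D l \in star v -> D l \in cut Z.
Hypothesis outZ : forall v, v \in Z -> D i \notin star v.

Lemma miss_not_cut u v : v \in Z -> u \in star v -> u \in misses m -> u \notin cut Z ->
  exists y l, [/\ y \in Z, y != v, u \in star y & D l \in star y].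
Proof.
case: (good) => ll _ _ _ vZ uv um uZ; have [b hb] := starP uv.
have us : u \in star (gends u (~~ b)) by apply: star_end.
have [l hl] := misses_skeleton good sk um us.
exists (gends u (~~ b)), l; split=> //.
  by move: uZ; rewrite (in_cut_end _ _ b) hb vZ /= negbK.
by rewrite -hb ends_neq //; case: (b).
Qed.

(** Here [v] is the only vertex of [Z] on the core. Its uncovered edge cannot end at another vertex
    of [Z], so it leaves [Z] together with [D j]. Deleting [v] leaves a 2-cut, and by parity its
    side has at least two vertices. *)
Lemma side_one v : v \in Z -> D j \in star v -> (forall w, w \in Z -> D k \notin star w) ->
  1 < #|Z| -> exists W, [/\ core_free D W, 1 < #|W| & #|cut W| <= 3].
Proof.
case: (good) => ll c3 _ _ vZ jv noK Z1.
have [u [g [[uv gv um] [gj uD gD] ug all]]] := at_skeleton good sk jv.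
have jZ := onZ vZ jv.
have only l y : y \in Z -> D l \in star y -> y = v.
  move=> yZ ly; case/or3P: (all3 l) => /eqP el; subst l.
  - by have := outZ yZ; rewrite ly.
  - exact: (cut_one_end jZ).
  - by have := noK y yZ; rewrite ly.
have uZ : u \in cut Z.
  apply/negPn/negP => /(miss_not_cut vZ uv um) [y [l [yZ yv _ ly]]].
  by rewrite (only l y) ?eqxx in yv.
have two : 1 < #|cut Z :&: star v|.
  by apply/card_gt1P; exists u, (D j); rewrite !in_setI uZ jZ uv jv.
have cd := cut_del vZ; rewrite c3 in cd.
have d1 := cardsD1 v Z; rewrite vZ in d1.
have /card_gt0P [y yW] : 0 < #|Z :\ v| by nlia.
have vW : v \notin Z :\ v by rewrite !inE eqxx.
have c2 := nontrivial_cut good yW vW.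
have oW := odd_card_cut good (Z :\ v).
exists (Z :\ v); split; last by nlia.
  move=> x l; rewrite in_setD1 => /andP [xv xZ]; apply/negP=> lx.
  by rewrite (only l x) ?eqxx in xv.
have e2 : #|cut (Z :\ v)| = 2 by nlia.
nlia.
Qed.

(** The core enters [Z] along [D j], follows the uncovered edge [u] from [v] to [w], and leaves
    along [D k]. Removing [v] and [w] keeps the cut at three edges or fewer, so the remainder is a
    splittable core-free set unless it is a single vertex. *)
Lemma side_two v w u : v \in Z -> w \in Z -> D j \in star v -> D k \in star w ->
  u \in star v -> u \in misses m -> u \notin cut Z ->
  (exists W, [/\ core_free D W, 1 < #|W| & #|cut W| <= 3]) \/ triangle_side m D Z i.
Proof.
case: (good) => ll c3 _ _ vZ wZ jv kw uv um uZ.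
have jZ := onZ vZ jv; have kZ := onZ wZ kw.
have ji : j != i by rewrite eq_sym.
have njk : D j != D k by apply: contraNneq jk => /(skeleton_inj sk) ->.
have kv : D k \notin star v by apply/negP=> /(skeleton_uniq2 sk jv) /eqP; rewrite (negbTE jk).
have vw : v != w by apply: contraNneq kv => ->.
have [y [l [yZ yv uy ly]]] := miss_not_cut vZ uv um uZ.
have {y l yZ yv uy ly} uw : u \in star w.
  case/or3P: (all3 l) => /eqP el; subst l.
  - by have := outZ yZ; rewrite ly.
  - by rewrite (cut_one_end jZ yZ vZ ly jv) eqxx in yv.
  - by rewrite -(cut_one_end kZ yZ wZ ly kw).
have onm X l : matching_on X (m l) by move=> x _; apply: (sk_array sk); rewrite inE.
have pj := odd_matching_cut good (onm Z j); have pi := odd_matching_cut good (onm Z i).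
rewrite -(odd_card_cut good) in pj pi.
have gi : 1 < #|m i :&: cut Z|.
  by apply/card_gt1P; exists (D j), (D k); rewrite !in_setI !(sk_mem sk) ij [i == k]eq_sym ki jZ kZ.
have gj : 0 < #|m j :&: cut Z|.
  by apply/card_gt0P; exists (D k); rewrite !in_setI !(sk_mem sk) jk kZ.
have lj : #|m j :&: cut Z| < #|cut Z|.
  apply: proper_card; apply/properP; split; first exact: subsetIr.
  by exists (D j) => //; rewrite in_setI (sk_mem sk) eqxx.
have li : #|m i :&: cut Z| <= #|cut Z| by apply/subset_leq_card/subsetIr.
(* Both matchings meet the cut in a number of edges with the parity of the cut. As [m j] contains
   [D k] but not [D j], a cut of two edges is impossible; then [m i], which contains both, takes all
   three. *)
have Z3 : #|cut Z| = 3 by nlia.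
have sub : cut Z \subset m i.
  have i3 : #|m i :&: cut Z| = 3 by rewrite Z3 in pi li; nlia.
  have /eqP <- : m i :&: cut Z == cut Z by rewrite eqEcard subsetIr i3 Z3.
  exact: subsetIl.
(* The edge of [m a] at an end of [D a] cannot cross: lying also in [m i] it would be the third edge
   [D b], and two such edges are never adjacent. *)
have notm g a x : a != i -> g \in star x -> D a \in star x -> g \in m a -> g \notin cut Z.
  move=> ai gx ax ga; apply/negP=> /(subsetP sub) gi'.
  have [b [bi ba allb]] := ord3_third (etrans (congr1 _ (eq_sym _ _)) ai).
  have ab : a != b by rewrite eq_sym.
  have ia : i != a by rewrite eq_sym.
  move: gx; rewrite (sk_uniq sk ia ab bi gi' ga) => bx.
  by rewrite (skeleton_uniq2 sk ax bx) eqxx in ab.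
have stv : cut Z :&: star v = [set D j].
  have [u1 [g1 [[u1v g1v u1m] [g1j u1D g1D] ug1 all]]] := at_skeleton good sk jv.
  have g1Z := notm g1 j v ji g1v jv g1j.
  have uu : u = u1.
    case/or3P: (all u uv) => /eqP // eu; move: um; rewrite mem_misses => /forallP.
      by move/(_ i); rewrite eu (sk_mem sk) ij.
    by move/(_ j); rewrite eu g1j.
  apply/setP=> e; rewrite in_setI in_set1; apply/andP/eqP => [[eZ ev]|->] //.
  case/or3P: (all e ev) => /eqP ee //; first by rewrite ee -uu (negbTE uZ) in eZ.
  by rewrite ee (negbTE g1Z) in eZ.
have stw : cut Z :&: star w = [set D k].
  have [u1 [g1 [[u1v g1v u1m] [g1j u1D g1D] ug1 all]]] := at_skeleton good sk kw.
  have g1Z := notm g1 k w ki g1v kw g1j.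
  have uu : u = u1.
    case/or3P: (all u uw) => /eqP // eu; move: um; rewrite mem_misses => /forallP.
      by move/(_ i); rewrite eu (sk_mem sk) eq_sym ki.
    by move/(_ k); rewrite eu g1j.
  apply/setP=> e; rewrite in_setI in_set1; apply/andP/eqP => [[eZ ev]|->] //.
  case/or3P: (all e ev) => /eqP ee //; first by rewrite ee -uu (negbTE uZ) in eZ.
  by rewrite ee (negbTE g1Z) in eZ.
(* Deleting [v] raises the cut to four edges. Now [w] has both [u] and [D k] in the cut, so deleting
   it brings the number back to at most three. *)
have cd := cut_del vZ; rewrite c3 stv cards1 Z3 in cd.
have wV : w \in Z :\ v by rewrite !inE eq_sym vw wZ.
have cd2 := cut_del wV; rewrite c3 in cd2.
have two : 1 < #|cut (Z :\ v) :&: star w|.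
  apply/card_gt1P; exists u, (D k); rewrite !in_setI !in_cut_del // (negbTE uZ) kZ uv (negbTE kv) uw kw.
  by split=> //; apply: contraTneq uv => ->.
have W3 : #|cut (Z :\ v :\ w)| <= 3 by nlia.
have cfW : core_free D (Z :\ v :\ w).
  move=> x l; rewrite !in_setD1 => /andP [xw /andP [xv xZ]]; apply/negP=> lx.
  case/or3P: (all3 l) => /eqP el; subst l.
  - by have := outZ xZ; rewrite lx.
  - by rewrite (cut_one_end jZ xZ vZ lx jv) eqxx in xv.
  - by rewrite (cut_one_end kZ xZ wZ lx kw) eqxx in xw.
have [W1|W1] := ltnP 1 #|Z :\ v :\ w|; first by left; exists (Z :\ v :\ w).
have d1 := cardsD1 v Z; rewrite vZ in d1.
have d2 := cardsD1 w (Z :\ v); rewrite wV in d2.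
have oZ := odd_card_cut good Z; rewrite Z3 in oZ.
have cZ : #|Z| = 3 by nlia.
right; split=> //.
- have := sum_star ll (cut Z) Z; rewrite setIid Z3.
  have -> : [set e in cut Z | inside Z e] = set0.
    apply/setP=> e; rewrite in_set in_set0; apply/negP=> /andP [h1 h2].
    by have := inside_cut h2; rewrite h1.
  rewrite cards0 (big_setD1 v) //= (big_setD1 w) //= stv stw !cards1 => sm z zZ.
  have [->|zv] := eqVneq z v; first by rewrite stv cards1.
  have [->|zw] := eqVneq z w; first by rewrite stw cards1.
  have /cards1P [z' hz] : #|Z :\ v :\ w| == 1 by apply/eqP; nlia.
  have : z \in Z :\ v :\ w by rewrite !in_setD1 zw zv zZ.
  by move: sm; rewrite hz big_set1 in_set1 => sm /eqP ->; nlia.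
- move=> l; case/or3P: (all3 l) => /eqP ->; rewrite ?eqxx ?ji ?ki //.
  apply/negP=> iZ; have [b [bZ _]] := cutP iZ.
  by have := outZ bZ; rewrite star_end.
Qed.

End Side.

Lemma cut_cases X : #|cut X| <= 3 -> 1 < #|X| -> 1 < #|~: X| ->
  (exists W, [/\ core_free D W, 1 < #|W| & #|cut W| <= 3]) \/
  (exists Z i, (Z = X \/ Z = ~: X) /\ triangle_side m D Z i).
Proof.
case: (good) => ll c3 _ _ h3 X1 X1'; have [Z [ZX _ onZ [i outZ]]] := side_exists h3.
have Z3 : #|cut Z| <= 3 by case: ZX => ->; rewrite ?cutC.
have Z1 : 1 < #|Z| by case: ZX => ->.
have [/existsP [v /andP [vZ /existsP [j jv]]]|no] :=
    boolP [exists v, (v \in Z) && [exists l, D l \in star v]]; last first.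
  left; exists Z; split=> // v l vZ; apply: contra no => lv.
  by apply/existsP; exists v; rewrite vZ; apply/existsP; exists l.
have ij : i != j by apply: contraTneq jv => <-; apply: outZ.
have [k [ki kj all]] := ord3_third ij.
have jk : j != k by rewrite eq_sym.
have [/existsP [w /andP [wZ kw]]|no] := boolP [exists w, (w \in Z) && (D k \in star w)];
    last first.
  left; apply: (side_one Z3 all onZ outZ vZ jv) => // w wZ; apply: contra no => kw.
  by apply/existsP; exists w; rewrite wZ.
have all' l : [|| l == i, l == k | l == j] by rewrite [(l == k) || _]orbC.
have [u [g [[uv _ um] [_ uD _] _ _]]] := at_skeleton good sk jv.
have [u' [g' [[uw _ um'] [_ uD' _] _ _]]] := at_skeleton good sk kw.
have fin : (exists W, [/\ core_free D W, 1 < #|W| & #|cut W| <= 3]) \/ triangle_side m D Z i.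
  have [uZ|uZ] := boolP (u \in cut Z); last first.
    by apply: (side_two Z3 ij jk ki all onZ outZ vZ wZ jv kw uv um uZ).
  have [uZ'|uZ'] := boolP (u' \in cut Z); last first.
    by apply: (side_two Z3 _ kj _ all' onZ outZ wZ vZ kw jv uw um' uZ'); rewrite eq_sym.
  have jZ := onZ j v vZ jv; have kZ := onZ k w wZ kw.
  (* If the uncovered edges at [v] and at [w] both left [Z], they would form with [D j] and [D k]
     four distinct cut edges. *)
  suff : 3 < #|cut Z| by rewrite ltnNge Z3.
  have nD x l : x \in misses m -> x != D l.
    rewrite mem_misses => /forallP h; have /card_gt0P [l'] : 0 < #|~: [set l]|.
      by rewrite cardsC1 card_ord.
    by rewrite !inE => ll'; apply: contraNneq (h l') => ->; rewrite (sk_mem sk).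
  have kv : D k \notin star v by apply/negP=> /(skeleton_uniq2 sk jv) /eqP; rewrite (negbTE jk).
  have vw : v != w by apply: contraNneq kv => ->.
  have uu : u != u'.
    apply: contraNneq vw => uu; rewrite -uu in uw.
    by apply/eqP; apply: cut_one_end uZ vZ wZ uv uw.
  have njk : D j != D k by apply: contraNneq jk => /(skeleton_inj sk) ->.
  have un : uniq [:: u; u'; D j; D k].
    by rewrite /= !inE !negb_or uu njk !nD.
  have sub : seq.all (mem (cut Z)) [:: u; u'; D j; D k] by rewrite /= uZ uZ' jZ kZ.
  by rewrite -[4]/(size [:: u; u'; D j; D k]) -(card_uniqP un); apply/subset_leq_card/subsetP=> x /(allP sub).
case: fin => [|h]; first by left.
by right; exists Z, i.
Qed.

End Sides.

(** * Disjoint triangles *)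

Lemma iter_gcd (T : Type) (f : T -> T) x a b : 0 < a ->
  iter a f x = x -> iter b f x = x -> iter (gcdn a b) f x = x.
Proof.
move=> a0 ha hb; have mul n k : iter n f x = x -> iter (k * n) f x = x.
  by move=> h; elim: k => // k IH; rewrite mulSn iterD IH.
have [u v h _] := egcdnP b a0.
have : iter (u * a) f x = x by apply: mul.
by rewrite h addnC iterD mul.
Qed.

(* The [s]/[t]-alternating walk from a fixed point [x] of [s] is a path; if it
   ends at a second fixed point of [s] then it meets no fixed point of [t]. *)
Lemma involution_path (T : finType) (s t : T -> T) x :
  involutive s -> involutive t -> s x = x ->
  exists O : {set T}, [/\ x \in O, (forall z, z \in O -> s z \in O),
    (forall z, z \in O -> t z \in O) &
    forall w y, w \in O -> y \in O -> s w = w -> w != x -> t y != y].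
Proof.
move=> sI tI sx; pose f := s \o t.
have fI : injective f := inj_comp (inv_inj sI) (inv_inj tI).
have back n : iter n f (s (iter n f x)) = x.
  elim: n => // n IH; rewrite (iterSr n f (s _)) (iterS n f x).
  by have -> z : f (s (f z)) = s z by rewrite /f /= sI tI.
have backt n : iter n.+1 f (t (iter n f x)) = x.
  by rewrite iterSr /f /= tI -/f back.
exists [set z | fconnect f x z]; split.
- by rewrite inE connect0.
- move=> z; rewrite !inE => /iter_findex <-; rewrite fconnect_sym //.
  have := fconnect_iter f (findex f x z) (s (iter (findex f x z) f x)).
  by rewrite back.
- move=> z; rewrite !inE => /iter_findex <-; rewrite fconnect_sym //.
  have := fconnect_iter f (findex f x z).+1 (t (iter (findex f x z) f x)).
  by rewrite backt.
move=> w y; rewrite !inE => /iter_findex <- /iter_findex <-.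
set n := findex f x w; set k := findex f x y => sw wx; apply/eqP=> ty.
(* Reversing the walk at a fixed point of [s] gives the even period [2n], at a fixed point of [t]
   the odd period [2k + 1]. Their gcd is an odd period that divides [n], which forces [w = x]. *)
have e1 : iter (n + n) f x = x by rewrite iterD; have := back n; rewrite sw.
have e2 : iter (k.+1 + k) f x = x by rewrite iterD; have := backt k; rewrite ty.
case/eqP: wx; have g0 : 0 < k.+1 + k by [].
have hg := iter_gcd g0 e2 e1; set g := gcdn _ _ in hg.
have /dvdnP [q ->] : g %| n.
  have g2 : coprime g 2.
    rewrite coprimen2; apply: dvdn_odd (dvdn_gcdl _ _) _.
    by rewrite addSn addnn /= odd_double.
  by rewrite -(Gauss_dvdr n g2) mul2n -addnn dvdn_gcdr.
by elim: q => // q IH; rewrite mulSn iterD IH.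
Qed.

Section Mates.
Variable G : graph.
Hypothesis ll : loopless G.
Variable F : {set gE G}.
Hypothesis Fm : forall v e f, e \in F -> f \in F -> e \in star v -> f \in star v -> e = f.

(** A partial matching seen as an involution on vertices: matched vertices are exchanged, free
    vertices are fixed. Alternating paths become orbits of two involutions. *)
Definition mate (v : gV G) :=
  if [pick e in F :&: star v] is Some e then
    if gends e false == v then gends e true else gends e false
  else v.

Lemma mateE e b : e \in F -> mate (gends e b) = gends e (~~ b).
Proof.
move=> eF; rewrite /mate; case: pickP => [f|/(_ e)]; last first.
  by rewrite in_setI eF star_end.
rewrite in_setI => /andP [fF fv].
by rewrite (Fm fF eF fv (star_end ll e b)) ends_neq //; case: b {fv}.
Qed.

Lemma mate_fix v : (forall e, e \in F -> e \notin star v) -> mate v = v.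
Proof.
move=> h; rewrite /mate; case: pickP => // e; rewrite in_setI => /andP [eF].
by rewrite (negbTE (h e eF)).
Qed.

Lemma mateK : involutive mate.
Proof.
move=> v; have [/existsP [e /andP [eF /starP [b <-]]]|no] :=
    boolP [exists e, (e \in F) && (e \in star v)].
  by rewrite !mateE // negbK.
have h e : e \in F -> e \notin star v.
  by move=> eF; apply: contra no => ev; apply/existsP; exists e; rewrite eF.
by rewrite !mate_fix.
Qed.

Lemma mate_closed (O : {set gV G}) e : (forall z, z \in O -> mate z \in O) ->
  e \in F -> e \notin cut O.
Proof.
move=> cl eF; apply/negP=> /cutP [b [bO nO]].
by have := cl _ bO; rewrite mateE // (negbTE nO).
Qed.

End Mates.

Section Kempe.
Variable G : graph.
Hypothesis good : good_graph G.
Implicit Types (X Y T O : {set gV G}) (e f : gE G) (v w : gV G).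
Variables (m : 'I_3 -> {set gE G}) (D : 'I_3 -> gE G).
Hypothesis sk : skeleton m D.

Lemma triangle_cut T k : triangle_side m D T k -> #|cut T| = 3.
Proof.
case: (good) => ll c3 _ _ tT; have := sum_star ll (cut T) T; rewrite setIid.
have -> : [set e in cut T | inside T e] = set0.
  apply/setP=> e; rewrite in_set in_set0; apply/negP=> /andP [h1 h2].
  by have := inside_cut h2; rewrite h1.
rewrite cards0 add0n (eq_bigr (fun=> 1)) => [<-|v vT]; last exact: (ts_star tT).
by rewrite sum1_card (ts_card tT).
Qed.

Lemma not_cut_inside X v e : v \in X -> e \in star v -> e \notin cut X -> inside X e.
Proof.
move=> vX /starP [b hb]; rewrite -hb in vX.
by rewrite (in_cut_end _ _ b) (insideE _ _ b) vX /= negbK.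
Qed.

Lemma inside_star X v e : inside X e -> e \in star v -> v \in X.
Proof. by move=> + /starP [b <-]; rewrite (insideE _ _ b) => /andP []. Qed.

(* Exchanging [m i] and [m k] inside [O] removes the only edge [D i] of [m j :&: m k]. *)
Lemma component_swap i j k O : i != j -> j != k -> k != i ->
  (forall e, e \in m i -> e \notin cut O) -> (forall e, e \in m k -> e \notin cut O) ->
  inside O (D i) -> ~~ inside O (D k) -> colourable3 G.
Proof.
move=> ij jk ki hi hk iO kO; apply/(colourable3P good).
pose M := [set e | if inside O e then e \in m i else e \in m k].
have inE' v e : e \in star v -> e \in m i \/ e \in m k -> inside O e = (v \in O).
  move=> ev em; apply/idP/idP => [/inside_star|vO]; first by apply.
  by apply: (not_cut_inside vO ev); case: em; [apply: hi|apply: hk].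
apply: (colourable_on_matchings good (M := M) (N := m j)).
- move=> v vT; have [vO|vO] := boolP (v \in O).
    rewrite -(sk_array sk i vT); congr #|pred_of_set _|; apply/setP=> e.
    rewrite !in_setI inE; case: (boolP (e \in star v)) => ev; rewrite ?andbF // !andbT.
    case: ifP => // eO; apply/idP/idP => em; rewrite (inE' v) ?vO // in eO; by [left|right].
  rewrite -(sk_array sk k vT); congr #|pred_of_set _|; apply/setP=> e.
  rewrite !in_setI inE; case: (boolP (e \in star v)) => ev; rewrite ?andbF // !andbT.
  by case: ifP => // eO; have := inside_star eO ev; rewrite (negbTE vO).
- exact: (sk_array sk j).
move=> v e _ _; rewrite inE; case: ifP => eO em; apply/negP=> ej.
  by move: kO; rewrite -(sk_uniq sk ij jk ki em ej) eO.
have kj : k != j by rewrite eq_sym.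
have ji : j != i by rewrite eq_sym.
have ik : i != k by rewrite eq_sym.
by move: iO; rewrite -(sk_uniq sk kj ji ik em ej) eO.
Qed.

Section Two.
Variables (T T' : {set gV G}) (i j k : 'I_3).
Hypothesis (ij : i != j) (jk : j != k) (ki : k != i).
Hypothesis (tT : triangle_side m D T k) (tT' : triangle_side m D T' i).
Hypothesis dT : [disjoint T & T'].

(** A Kempe chain of [m i] and [m k] is started at the end [vi] of [D i] in [T], leaving out the
    edges of [m i] inside [T] and those of [m k] inside [T']. The omitted edge [g] makes [vi] and
    [w] free. If the chain also contains [w], it contains no free end in [T'], neither matching
    crosses it, and [component_swap] applies. Otherwise the exchange along the chain separates the
    colours of [D i] and of the cut edge at [w], which were both [k], so that the cut of [T] shows
    three colours. *)
Lemma two_triangles : colourable3 G.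
Proof.
case: (good) => ll c3 _ _.
have kj : k != j by rewrite eq_sym.
have ji : j != i by rewrite eq_sym.
have ik : i != k by rewrite eq_sym.
have end_cut X e : e \in cut X -> exists2 v, v \in X & e \in star v.
  by case/cutP=> b [bX _]; exists (gends e b); rewrite ?star_end.
have iT : D i \in cut T by rewrite (ts_mem tT).
have jT : D j \in cut T by rewrite (ts_mem tT).
have kT' : D k \in cut T' by rewrite (ts_mem tT').
have jT' : D j \in cut T' by rewrite (ts_mem tT').
have [vi viT Dvi] := end_cut _ _ iT; have [vj vjT Dvj] := end_cut _ _ jT.
have [vk vkT' Dvk] := end_cut _ _ kT'.
have [g gi gv] := matching_edge (sk_array sk i) (in_setT vi).
(* If [g] left [T] it would lie in [m k] as well, hence be [D j], which is not adjacent to [D i]. *)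
have gT : inside T g.
  apply: (not_cut_inside viT gv); apply/negP=> gT.
  have gk := subsetP (ts_sub tT) _ gT.
  have := sk_uniq sk ik kj ji gi gk => gD; rewrite gD in gv.
  by have := skeleton_uniq2 sk Dvi gv => /eqP; rewrite (negbTE ij).
have [b gb] := starP gv; pose w := gends g (~~ b).
have gw : g \in star w by apply: star_end.
have wT : w \in T by apply: inside_star gT gw.
have wvi : w != vi by rewrite /w -gb ends_neq //; case: (b).
have vij : vi != vj.
  apply/eqP=> hh; rewrite hh in Dvi; have := skeleton_uniq2 sk Dvi Dvj => /eqP.
  by rewrite (negbTE ij).
have wvj : w != vj.
  apply: contraTneq gT => hh; rewrite hh in gw.
  rewrite (matching_uniq (sk_array sk i) (in_setT vj) gi _ gw Dvj) ?(sk_mem sk) //.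
  by apply/negP=> /inside_cut; rewrite jT.
have Teq z : z \in T -> [|| z == vi, z == vj | z == w].
  move=> zT; apply/negPn/negP; rewrite !negb_or => /and3P [z1 z2 z3].
  have un : uniq [:: z; vi; vj; w] by rewrite /= !inE !negb_or z1 z2 z3 vij ![_ == w]eq_sym wvi wvj.
  suff : 4 <= #|T| by rewrite (ts_card tT).
  have sub : all (mem T) [:: z; vi; vj; w] by rewrite /= zT viT vjT wT.
  by rewrite -[4]/(size [:: z; vi; vj; w]) -(card_uniqP un); apply/subset_leq_card/subsetP=> x /(allP sub).
pose F1 := [set e in m i | ~~ inside T e]; pose F2 := [set e in m k | ~~ inside T' e].
have F1m v e f : e \in F1 -> f \in F1 -> e \in star v -> f \in star v -> e = f.
  move=> /setIdP [e1 _] /setIdP [f1 _].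
  exact: (matching_uniq (sk_array sk i) (in_setT v)).
have F2m v e f : e \in F2 -> f \in F2 -> e \in star v -> f \in star v -> e = f.
  move=> /setIdP [e1 _] /setIdP [f1 _].
  exact: (matching_uniq (sk_array sk k) (in_setT v)).
have fix1 v : g \in star v -> mate F1 v = v.
  move=> hv; apply: mate_fix => e; rewrite in_set => /andP [ei eT].
  by apply: contra eT => ev; rewrite (matching_uniq (sk_array sk i) (in_setT v) ei gi).
have [O [viO cl1 cl2 alt]] :=
  involution_path (mateK ll F1m) (mateK ll F2m) (fix1 vi gv).
have nc1 e : e \in F1 -> e \notin cut O by apply: mate_closed.
have nc2 e : e \in F2 -> e \notin cut O by apply: mate_closed.
have DiO : inside O (D i).
  apply: (not_cut_inside viO Dvi); apply: nc2; rewrite in_set (sk_mem sk) ki /=.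
  by apply/negP=> /inside_star /(_ Dvi); rewrite (disjointFr dT viT).
have [wO|wO] := boolP (w \in O).
  have fix2 e v : e \in m k -> inside T' e -> e \in star v -> v \notin O.
    move=> ek eT ev; apply/negP=> vO; have := alt w v wO vO (fix1 w gw) wvi.
    rewrite mate_fix ?eqxx // => f; rewrite in_set => /andP [fk fT].
    by apply: contra fT => fv; rewrite (matching_uniq (sk_array sk k) (in_setT v) fk ek).
  apply: (component_swap ij jk ki (O := O)) => // [e ei|e ek|].
  - have [eT|eT] := boolP (inside T e); last by apply: nc1; rewrite in_set ei.
    (* [T] consists of [vi], [vj] and [w], and at [vj] the matching [m i] uses [D j], which leaves
       [T]. So [g] is its only edge inside [T], and both ends of [g] are in [O]. *)
    suff -> : e = g by apply: inside_cut; rewrite (insideE _ _ b) gb viO.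
    have ev b' : gends e b' != vj.
      apply: contraTneq eT => hh; have ev : e \in star vj by rewrite -hh star_end.
      rewrite (matching_uniq (sk_array sk i) (in_setT vj) ei _ ev Dvj) ?(sk_mem sk) //.
      by apply/negP=> /inside_cut; rewrite jT.
    have [b' hb'] : exists b', gends e b' = vi.
      have := eT; rewrite /inside => /andP [t1 t2].
      case/or3P: (Teq _ t1) => /eqP h1; first by exists false.
        by have := ev false; rewrite h1 eqxx.
      case/or3P: (Teq _ t2) => /eqP h2; first by exists true.
        by have := ev true; rewrite h2 eqxx.
      by have := ll e; rewrite h1 h2 eqxx.
    apply: (matching_uniq (sk_array sk i) (in_setT vi) ei gi _ gv).
    by rewrite -hb' star_end.
  - have [eT|eT] := boolP (inside T' e); last by apply: nc2; rewrite in_set ek.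
    apply/negP=> /cutP [b' [bO _]].
    by have := fix2 e _ ek eT (star_end ll e b'); rewrite bO.
  (* The edge of [m k] at [vk] stays inside [T'], so [vk] is fixed by the second involution and
     cannot be in [O]. *)
  apply/negP=> /inside_star /(_ Dvk) vkO.
  have [h hk hv] := matching_edge (sk_array sk k) (in_setT vk).
  have hT' : inside T' h.
    apply: (not_cut_inside vkT' hv); apply/negP=> hT.
    have hi := subsetP (ts_sub tT') _ hT.
    have := sk_uniq sk ik kj ji hi hk => hD; rewrite hD in hv.
    by have := skeleton_uniq2 sk Dvk hv => /eqP; rewrite (negbTE kj).
  by have := fix2 h vk hk hT' hv; rewrite vkO.
(* The colouring induced by [m i] and [m k], with these two colours exchanged inside [O]. *)
pose c e := if (e \in m i) == (e \in m k) then j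
  else if (e \in m i) (+) inside O e then i else k.
have cT : #|cut T| = 3 := triangle_cut tT.
have cT' : #|cut T'| = 3 := triangle_cut tT'.
have cY : proper_on (~: (T :|: T')) c.
  move=> v; rewrite in_setC in_setU negb_or => /andP [vT vT'].
  have [e1 e1i e1v] := matching_edge (sk_array sk i) (in_setT v).
  have [e2 e2k e2v] := matching_edge (sk_array sk k) (in_setT v).
  have e12 : e1 != e2.
    (* A common edge would be [D j], which has one end in [T] and the other in [T']. *)
    apply/eqP=> h; rewrite -h in e2k; have hD := sk_uniq sk ik kj ji e1i e2k.
    have [b1 [b1T b1']] := cutP jT; have [b2 [b2T b2']] := cutP jT'.
    have b12 : b2 = ~~ b1.
      have bb : b2 != b1 by apply: contraTneq b2T => ->; rewrite (disjointFr dT b1T).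
      by move: bb; case: (b1); case: (b2).
    case/starP: e1v => b3; rewrite hD => hv; have [hh|hh] := eqVneq b3 b1.
      by rewrite -hv hh b1T in vT.
    have b32 : b3 = b2 by rewrite b12; move: hh; case: (b3); case: (b1).
    by rewrite -hv b32 b2T in vT'.
  have n1k : e1 \notin m k.
    by apply: contra e12 => h; apply/eqP/(matching_uniq (sk_array sk k) (in_setT v)).
  have n2i : e2 \notin m i.
    by apply: contra e12 => h; apply/eqP/(matching_uniq (sk_array sk i) (in_setT v)).
  have [e3 [e3v e31 e32 all]] := star_third good e1v e2v e12.
  have n3i : e3 \notin m i.
    by apply: contra e31 => h; apply/eqP/(matching_uniq (sk_array sk i) (in_setT v)).
  have n3k : e3 \notin m k.
    by apply: contra e32 => h; apply/eqP/(matching_uniq (sk_array sk k) (in_setT v)).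
  have o1 : inside O e1 = (v \in O).
    apply/idP/idP => [/inside_star|vO]; first by apply.
    apply: (not_cut_inside vO e1v (nc1 _ _)); rewrite in_set e1i /=.
    by apply: contra vT => /inside_star; apply.
  have o2 : inside O e2 = (v \in O).
    apply/idP/idP => [/inside_star|vO]; first by apply.
    apply: (not_cut_inside vO e2v (nc2 _ _)); rewrite in_set e2k /=.
    by apply: contra vT' => /inside_star; apply.
  have c1 : c e1 = if v \in O then k else i by rewrite /c e1i (negbTE n1k) o1; case: (v \in O).
  have c2 : c e2 = if v \in O then i else k by rewrite /c e2k (negbTE n2i) o2; case: (v \in O).
  have c3' : c e3 = j by rewrite /c (negbTE n3i) (negbTE n3k).
  move=> x y xv yv; case/or3P: (all x xv) => /eqP ->; case/or3P: (all y yv) => /eqP -> //;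
    rewrite ?c1 ?c2 ?c3'; case: (v \in O) => /eqP;
    rewrite ?(negbTE ij) ?(negbTE jk) ?(negbTE ki) ?(negbTE ik) ?(negbTE kj) ?(negbTE ji) //.
have inj : {in cut T &, injective c}.
  have at_z e : e \in cut T -> [|| e == D i, e == D j | (e \in star w) && (c e == k)].
    move=> eT; have [z zT ez] := end_cut _ _ eT; have star1 := eqP (introT eqP (ts_star tT zT)).
    have u1 f : f \in cut T -> f \in star z -> e = f.
      move=> fT fz; apply/eqP/negPn/negP=> nef; suff : 1 < #|cut T :&: star z| by rewrite star1.
      by apply/card_gt1P; exists e, f; rewrite !in_setI eT fT ez fz.
    case/or3P: (Teq z zT) => /eqP zz; rewrite zz in ez u1.
    - by rewrite (u1 (D i)) ?eqxx.
    - by rewrite (u1 (D j)) ?eqxx ?orbT.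
    apply/or3P/Or33; rewrite ez /= /c (subsetP (ts_sub tT) _ eT).
    have -> : (e \in m i) = false.
      apply/negP=> ei; have eg := matching_uniq (sk_array sk i) (in_setT w) ei gi ez gw.
      by have := inside_cut gT; rewrite -eg eT.
    by rewrite /=; case: ifP => // /inside_star /(_ ez); rewrite (negbTE wO).
  have ci : c (D i) = i by rewrite /c !(sk_mem sk) eqxx ki /= DiO.
  have cj : c (D j) = j by rewrite /c !(sk_mem sk) ij kj.
  have uw x y : x \in cut T -> y \in cut T -> x \in star w -> y \in star w -> x = y.
    move=> xT yT xw yw; apply/eqP/negPn/negP=> nxy.
    suff : 1 < #|cut T :&: star w| by rewrite (ts_star tT wT).
    by apply/card_gt1P; exists x, y; rewrite !in_setI xT yT xw yw.
  move=> x y xT yT; case/or3P: (at_z x xT) => [/eqP ->|/eqP ->|/andP [xw /eqP cx]];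
    case/or3P: (at_z y yT) => [/eqP ->|/eqP ->|/andP [yw /eqP cy]]; rewrite ?ci ?cj ?cx ?cy // => /eqP;
    rewrite ?(negbTE ij) ?(negbTE jk) ?(negbTE ki) ?(negbTE ik) ?(negbTE kj) ?(negbTE ji) //.
  by move=> _; apply: uw.
(* Only [T] needs the distinct colours: once it is filled in, everything outside [T'] is coloured
   and parity governs the cut of [T']. *)
apply: (colourable_glue good (X := T')); first by rewrite cT'.
  exact: (colourable_on_skeleton good sk (ts_out tT')).
have -> : ~: T' = T :|: ~: (T :|: T').
  apply/setP=> z; rewrite !(in_setC, in_setU).
  by have [zT|zT] := boolP (z \in T); rewrite //= (disjointFr dT zT).
apply: (proper_extend good _ _ cY (colourable_on_skeleton good sk (ts_out tT))).
- by rewrite cT.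
- by rewrite -setI_eq0 setCU setIA setICr set0I.
- by right.
Qed.

End Two.

(* The three edges of [misses m] are one in each triangle and one parallel to [D k]. *)
Lemma equal_triangles T T' k : triangle_side m D T k -> triangle_side m D T' k ->
  [disjoint T & T'] -> colourable3 G.
Proof.
case: (good) => ll c3 _ _ tT tT' dT.
have /card_gt0P [i] : 0 < #|~: [set k]| by rewrite cardsC1 card_ord.
rewrite !inE => ik; have [j [ji jk all]] := ord3_third ik.
have missT Z : triangle_side m D Z k -> exists u, u \in misses m /\ inside Z u.
  move=> tZ; have : D i \in cut Z by rewrite (ts_mem tZ).
  case/cutP=> b [bZ _]; have Dv := star_end ll (D i) b.
  have [u [g [[uv gv um] _ _ _]]] := at_skeleton good sk Dv.
  exists u; split=> //; apply: (not_cut_inside bZ uv); apply/negP=> /(subsetP (ts_sub tZ)).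
  by move: um; rewrite mem_misses => /forallP /(_ k) /negbTE ->.
have [u [um uT]] := missT T tT; have [u' [um' uT']] := missT T' tT'.
have atk b : exists p, [/\ p \in misses m, p \in star (gends (D k) b), ~~ inside T p & ~~ inside T' p].
  have Dv := star_end ll (D k) b.
  have [p [g [[pv gv pm] _ _ _]]] := at_skeleton good sk Dv.
  exists p; split=> //; apply/negP=> /inside_star /(_ pv) h.
    by have := ts_out tT h; rewrite Dv.
  by have := ts_out tT' h; rewrite Dv.
have [p [pm p1 pT pT']] := atk false; have [q [qm q2 qT qT']] := atk true.
have uu : u != u'.
  apply/eqP=> h; rewrite -h in uT'; have h1 := inside_star uT (star_end ll u false).
  by have := inside_star uT' (star_end ll u false); rewrite (disjointFr dT h1).
have pq : p = q.
  apply/eqP/negPn/negP=> npq; suff : 3 < #|misses m| by rewrite ltnNge (sk_misses sk).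
  have un : uniq [:: u; u'; p; q].
    have up : u != p by apply: contraNneq pT => <-.
    have uq : u != q by apply: contraNneq qT => <-.
    have up' : u' != p by apply: contraNneq pT' => <-.
    have uq' : u' != q by apply: contraNneq qT' => <-.
    by rewrite /= !inE !negb_or uu npq up uq up' uq'.
  have sub : seq.all (mem (misses m)) [:: u; u'; p; q] by rewrite /= um um' pm qm.
  by rewrite -[4]/(size [:: u; u'; p; q]) -(card_uniqP un); apply/subset_leq_card/subsetP=> x /(allP sub).
rewrite -pq in q2.
have pn l : p \notin m l by move: pm; rewrite mem_misses => /forallP.
have ij : i != j by rewrite eq_sym.
have ki : k != i by rewrite eq_sym.
have hmm : m i :&: m j = [set D k].
  apply/setP=> e; rewrite in_setI in_set1; apply/andP/eqP => [[ei ej]|->].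
    exact: (sk_uniq sk ij jk ki ei ej).
  by rewrite !(sk_mem sk) ik jk.
apply: (colourable_swap good (sk_array sk i) (sk_array sk j) hmm (pn j)).
  by apply: contraNneq (pn i) => ->; rewrite (sk_mem sk) ik.
have [b1 hb1] := starP p1; have [b2 hb2] := starP q2.
have b12 : b2 = ~~ b1.
  have : gends p b1 != gends p b2 by rewrite hb1 hb2.
  by rewrite ends_neq //; case: b1 {hb1}; case: b2 {hb2}.
move=> v; rewrite (in_starE ll p v b1) -b12 hb1 hb2.
by rewrite (in_starE ll (D k) v false).
Qed.

Lemma disjoint_triangles T T' i k : triangle_side m D T k -> triangle_side m D T' i ->
  [disjoint T & T'] -> colourable3 G.
Proof.
move=> tT tT' dT; have [ki|ki] := eqVneq k i.
  by subst i; apply: equal_triangles tT tT' dT.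
have [j [jk ji _]] := ord3_third ki.
apply: (two_triangles (i := i) (j := j) (k := k) _ jk ki tT tT' dT).
by rewrite eq_sym.
Qed.

(** If [x] and [z] were not adjacent, the two inner edges at each of them would all end at the third
    vertex, which has only three edges. *)
Lemma triangle_joins T k : triangle_side m D T k -> forall x z, x \in T -> z \in T ->
  x != z -> exists e, (e \in star x) && (e \in star z).
Proof.
case: (good) => ll c3 _ _ tT x z xT zT xz; apply/existsP; apply: contraT.
rewrite negb_exists => /forallP no.
have /cards1P [y hy] : #|T :\ x :\ z| == 1.
  have := cardsD1 x T; have := cardsD1 z (T :\ x); rewrite !in_setD1 xT zT eq_sym xz (ts_card tT) /=.
  by move=> h1 h2; apply/eqP; nlia.
have sub t s : t \in T -> s \in T -> t != s -> (t = x \/ t = z) -> (s = x \/ s = z) ->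
    star t :\: cut T \subset star y.
  move=> tT' sT ts tx sx; apply/subsetP=> e; rewrite in_setD => /andP [eT et].
  have [b hb] := starP et; have eI := not_cut_inside tT' et eT.
  have oT : gends e (~~ b) \in T := inside_star eI (star_end ll e (~~ b)).
  have ne : gends e (~~ b) != t by rewrite -hb ends_neq //; case: (b).
  have ns : gends e (~~ b) != s.
    apply/eqP=> h; have := no e; have es : e \in star s by rewrite -h star_end.
    by case: tx sx => ht [] hs; move: ts et es; rewrite ht hs ?eqxx // => _ -> ->.
  have : gends e (~~ b) \in T :\ x :\ z.
    by rewrite !in_setD1 oT andbT; case: tx sx => ht [] hs; move: ts ne ns; rewrite ht hs ?eqxx // => _ -> ->.
  by rewrite hy in_set1 => /eqP <-; apply: star_end.
have s1 := sub x z xT zT xz (or_introl erefl) (or_intror erefl).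
have s2 : star z :\: cut T \subset star y.
  by apply: (sub z x) => //; [rewrite eq_sym|right|left].
have cnt t : t \in T -> #|star t :\: cut T| = 2.
  by move=> tT'; have := cardsID (cut T) (star t); rewrite c3 setIC (ts_star tT) //; nlia.
have : #|(star x :\: cut T) :|: (star z :\: cut T)| <= 3.
  by rewrite -(c3 y); apply: subset_leq_card; rewrite subUset s1 s2.
have := cardsUI (star x :\: cut T) (star z :\: cut T); rewrite !cnt //.
have -> : (star x :\: cut T) :&: (star z :\: cut T) = set0.
  apply/setP=> e; rewrite !(in_setI, in_setD) in_set0; apply/negP=> /andP [/andP [_ h1] /andP [_ h2]].
  by have := no e; rewrite h1 h2.
by rewrite cards0; nlia.
Qed.

End Kempe.

(** * Completions *)

(* What the two kinds of completion of the side [X] have in common; [psi] sends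
   an edge of [K] to the edge of [H] it comes from. *)
Record completion (H : graph) (X : {set gV H}) (K : graph)
    (psi : gE K -> option (gE H)) : Prop := Completion {
  cp_good : good_graph K;
  cp_card : #|gV K| < #|gV H|;
  cp_colour : colourable3 K <-> colourable_on X;
  cp_array : forall m D, skeleton m D -> core_free D (~: X) ->
    exists2 m', array m' &
      forall k, mult m' k = if psi k is Some e then mult m e else 1;
  cp_inj : forall k k' e, psi k = Some e -> psi k' = Some e -> k = k';
  cp_inside : forall e, inside X e -> exists k, psi k = Some e }.

Lemma core_free_cut (G : graph) (m : 'I_3 -> {set gE G}) D X e i j :
  good_graph G -> skeleton m D -> core_free D X -> e \in cut X ->
  e \in m i -> e \in m j -> i = j.
Proof.
move=> good sk free /cutP [b [bX _]] ei ej; have [ll _ _ _] := good.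
have /eqP/mult1P [l _ hl] := off_skeleton good sk (free _ ^~ bX) (star_end ll e b).
by rewrite (hl i ei) (hl j ej).
Qed.

(** * Completion along a 3-cut *)

Section Contract.
Variable H : graph.
Hypothesis good : good_graph H.
Variable S : {set gV H}.
Hypothesis S0 : S != set0.
Let K := contract S [set e | inside S e].
Implicit Types (A : {set gV K}) (k : gE K) (x : gV K).

(** Preimage under the contraction map, which is [insub]: it sends all of [S] to [None]. Cuts of [K]
    are exactly the cuts of such preimages, which transfers degrees and edge-connectivity. *)
Definition uncontract A : {set gV H} := [set v | (insub v : gV K) \in A].

Lemma gends_contract A k b : (gends k b \in A) = (gends (val k) b \in uncontract A).
Proof. by rewrite inE. Qed.

Lemma contract_edge e : ~~ inside S e -> exists k : gE K, val k = e.
Proof.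
move=> h; have h' : e \notin [set e | inside S e] by rewrite inE.
by exists (Sub e h'); rewrite SubK.
Qed.

Lemma cut_contract A : [set val k | k in cut A] = cut (uncontract A).
Proof.
apply/setP=> e; apply/imsetP/idP => [[k kA ->]|eA].
  by move: kA; rewrite [k \in _]in_cut (gends_contract A k false) (gends_contract A k true) -in_cut.
have [|k hk] := @contract_edge e.
  apply/negP=> /andP [h1 h2]; move: eA; rewrite in_cut !inE.
  by rewrite !insubF ?h1 ?h2 ?addbb.
exists k => //; move: eA.
by rewrite -hk [k \in _]in_cut (gends_contract A k false) (gends_contract A k true) -in_cut.
Qed.

Lemma card_cut_contract A : #|cut A| = #|cut (uncontract A)|.
Proof. by rewrite -cut_contract card_imset //; apply: val_inj. Qed.

Lemma uncontract_Some (v : {v | v \notin S}) : uncontract [set Some v] = [set val v].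
Proof.
apply/setP=> w; rewrite !inE; apply/eqP/eqP => [|->]; last by rewrite valK.
by case: insubP => // u _ <- [->].
Qed.

Lemma uncontract_None : uncontract [set None] = S.
Proof.
apply/setP=> w; rewrite !inE; case: insubP => [u /negbTE ->|] //.
by rewrite negbK => ->.
Qed.

Lemma uncontractC A : uncontract (~: A) = ~: uncontract A.
Proof. by apply/setP=> w; rewrite !inE. Qed.

Lemma uncontract_surj x : exists v, insub v = x.
Proof.
case: x => [v|]; first by exists (val v); rewrite valK.
by have [v vS] := set0Pn _ S0; exists v; rewrite insubF // vS.
Qed.

Lemma card_uncontract A : #|A| <= #|uncontract A|.
Proof.
apply: leq_trans (leq_imset_card (insub : gV H -> gV K) _).
apply/subset_leq_card/subsetP=> x xA; have [v hv] := uncontract_surj x.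
by apply/imsetP; exists v; rewrite ?inE hv.
Qed.

Lemma sub_uncontract A : None \in A -> S \subset uncontract A.
Proof. by move=> NA; apply/subsetP=> v vS; rewrite inE insubF // vS. Qed.

Lemma contract_loopless : loopless K.
Proof.
case: good => ll _ _ _ k; apply/negP=> /eqP; have := valP k; rewrite inE /inside /=.
case: insubP => [u nu hu|nu]; case: insubP => [w nw hw|nw] //.
  by move=> _ [uw]; have := ll (val k); rewrite -hu -hw uw eqxx.
by rewrite !negbK in nu nw; rewrite nu nw.
Qed.

Hypothesis S3 : #|cut S| = 3.

Lemma contract_good : good_graph K.
Proof.
case: (good) => ll c3 ec _; split.
- exact: contract_loopless.
- case=> [v|]; rewrite card_cut_contract; first by rewrite uncontract_Some c3.
  by rewrite uncontract_None.
- move=> A A0 AT; rewrite card_cut_contract; apply: ec.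
    rewrite -card_gt0; apply: leq_trans (card_uncontract A).
    by rewrite card_gt0.
  apply: contra AT => /eqP hA; apply/eqP/setP=> x; rewrite in_setT.
  by have [v <-] := uncontract_surj x; have := in_setT v; rewrite -hA inE.
by apply/card_gt0P; exists None.
Qed.

Lemma card_contract : #|gV K| = (#|~: S|).+1.
Proof.
by rewrite card_option card_sig; congr _.+1; apply: eq_card => v; rewrite !inE.
Qed.

Lemma star_contract_Some (v : {v | v \notin S}) :
  [set val k | k in star (Some v : gV K)] = star (val v).
Proof. by rewrite cut_contract uncontract_Some. Qed.

Lemma mem_star_contract k x : k \in star x -> val k \in cut (uncontract [set x]).
Proof. by move=> h; rewrite -cut_contract imset_f. Qed.

Lemma contract_colour : colourable3 K <-> colourable_on (~: S).
Proof.
rewrite (colourable3P contract_good); split=> [[c hc]|[c hc]].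
  exists (fun e => if insub e is Some k then c k else ord0) => v vS e f ev fv.
  rewrite inE in vS; pose x := Some (Sub v vS) : gV K.
  have ex g : g \in star v -> exists2 k : gE K, k \in star x & g = val k.
    by move=> gv; move: gv; rewrite -[v](SubK (sig (fun v => v \notin S)) vS) -star_contract_Some => /imsetP.
  have [k kx ->] := ex e ev; have [k' kx' ->] := ex f fv.
  by rewrite !valK => /(hc x (in_setT _) _ _ kx kx') ->.
exists (fun k => c (val k)) => x _ k k' kx kx' hk; apply: val_inj.
have := mem_star_contract kx; have := mem_star_contract kx'; case: x {kx kx'} => [v|].
  by rewrite uncontract_Some => h1 h2; apply: (hc (val v)); rewrite // inE (valP v).
rewrite uncontract_None => h1 h2.
by apply: (proper_cut3 good hc); rewrite ?cutC.
Qed.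

(** Each matching has an odd number of edges in the 3-cut. If one had all three, an edge of another
    matching in the cut would be doubly covered, although it has an end off the core. So each has
    exactly one, and it covers the new vertex. *)
Lemma contract_array m D : skeleton m D -> core_free D S ->
  exists2 m' : 'I_3 -> {set gE K}, array m' & forall k, mult m' k = mult m (val k).
Proof.
move=> sk free; have cS i : #|m i :&: cut S| = 1.
  have par l : odd #|m l :&: cut S|.
    have arr0 : matching_on S (m l) by move=> v _; apply: (sk_array sk); rewrite inE.
    by rewrite (odd_matching_cut good arr0) -(odd_card_cut good) S3.
  have le3 : #|m i :&: cut S| <= 3 by rewrite -S3; apply/subset_leq_card/subsetIr.
  have [h3|] := eqVneq #|m i :&: cut S| 3; last by have := par i; move: le3; nlia.
  have sub : cut S \subset m i.
    have /eqP <- : m i :&: cut S == cut S by rewrite eqEcard subsetIr S3 h3.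
    exact: subsetIl.
  have /card_gt0P [j] : 0 < #|~: [set i]| by rewrite cardsC1 card_ord.
  rewrite !inE; have /card_gt0P [e] : 0 < #|m j :&: cut S| by have := par j; case: #|_|.
  rewrite in_setI => /andP [ej eS] /eqP [].
  exact: (core_free_cut good sk free eS ej (subsetP sub _ eS)).
exists (fun i => [set k | val k \in m i]).
  move=> i x _; have -> : #|[set k : gE K | val k \in m i] :&: star x| =
      #|m i :&: cut (uncontract [set x])|.
    rewrite -cut_contract -(card_imset _ val_inj); apply: eq_card => e.
    rewrite in_setI; apply/imsetP/andP => [[k]|[ei /imsetP [k kx ek]]].
      by rewrite in_setI inE => /andP [ki kx] ->; rewrite ki imset_f.
    by exists k; rewrite // in_setI inE -ek ei.
  case: x => [v|]; last by rewrite uncontract_None.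
  by rewrite uncontract_Some; apply: (sk_array sk); rewrite inE.
by move=> k; apply: eq_card => i; rewrite !inE.
Qed.

End Contract.

Lemma compl3_completion (H : graph) (X : {set gV H}) : good_graph H ->
  1 < #|~: X| -> #|cut X| = 3 ->
  @completion H X (compl3 X) (@contract_map H (~: X) [set e | inside (~: X) e]).
Proof.
move=> good X1 X3; have S0 : ~: X != set0 by rewrite -card_gt0; nlia.
have S3 : #|cut (~: X)| = 3 by rewrite cutC.
split.
- exact: contract_good.
- by rewrite card_contract setCK; have := cardsC X; move: X1; nlia.
- by rewrite (contract_colour good S0 S3) setCK.
- by move=> m D sk free; apply: contract_array sk free.
- by move=> k k' e [<-] [/val_inj ->].
move=> e eX; have [|k hk] := @contract_edge H (~: X) e; last by exists k; rewrite /contract_map hk.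
by move: eX; rewrite /inside !inE => /andP [-> ->].
Qed.

(** * Completion along a 2-cut *)

Section Compl2.
Variable H : graph.
Hypothesis good : good_graph H.
Variables (X : {set gV H}) (r : bool -> gE H) (hr : forall b, xend X (r b) \in X).
Hypotheses (cX : cut X = [set r false; r true]) (rr : r false != r true).
Hypothesis indep : independent (cut X).
Let K := compl2 hr.
Implicit Types (A : {set gV K}) (k : gE K) (x : gV K).
Let d b : gV K := exist _ (xend X (r b)) (hr b).

Lemma r_cut b : r b \in cut X.
Proof. by rewrite cX in_set2; case: b; rewrite eqxx ?orbT. Qed.

Lemma r_end b : exists c, [/\ gends (r b) c = xend X (r b) & gends (r b) (~~ c) \notin X].
Proof.
have := r_cut b; rewrite in_cut /xend; case: ifP => h.
  by move=> h'; exists false.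
by exists true; rewrite /= h.
Qed.

Lemma d_neq : d false != d true.
Proof.
apply/negP=> /eqP /(congr1 val) /= h; have [c [h1 _]] := r_end false.
have [c' [h2 _]] := r_end true; have := indep (r_cut false) (r_cut true) rr c c'.
by rewrite h1 h2 h eqxx.
Qed.

Lemma val_gends k b : val (gends k b) = if k is inl e then gends (val e) b else xend X (r b).
Proof.
case: k => [e|[]] /=; last by rewrite val_insubd hr.
rewrite val_insubd; have := valP e; rewrite /inside.
by case: b => /andP [h1 h2]; rewrite ?h1 ?h2.
Qed.

(* A cut of the completion is a cut of [H] after putting [~: X] on the side of the end
   [d b] of the new edge; the new edge then plays the role of [r (~~ b)]. *)
Definition edge_to b k : gE H := if k is inl e then val e else r (~~ b).

Definition unsplit_side b A : {set gV H} :=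
  [set v | if v \in X then (insubd (d false) v : gV K) \in A else d b \in A].

Lemma mem_unsplit b A x : (val x \in unsplit_side b A) = (x \in A).
Proof. by rewrite inE (valP x) valKd. Qed.

Lemma edge_to_inj b : injective (edge_to b).
Proof.
move=> [e|[]] [f|[]] //= h; first by congr inl; apply: val_inj.
  by have hv : val e = r (~~ b) := h; have := inside_cut (valP e); rewrite hv r_cut.
by have hv : r (~~ b) = val f := h; have := inside_cut (valP f); rewrite -hv r_cut.
Qed.

Lemma cut_compl2 b A : [set edge_to b k | k in cut A] = cut (unsplit_side b A).
Proof.
have [c [h1 h2]] := r_end (~~ b).
apply/setP=> e; apply/imsetP/idP => [[k kA ->]|eA].
  move: kA; rewrite [k \in cut A]in_cut -!(mem_unsplit b) !val_gends.
  case: k => [f|[]] /=; first by rewrite in_cut.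
  rewrite (in_cut_end _ _ c) h1 [_ (~~ c) \in _]inE (negbTE h2).
  rewrite -(mem_unsplit b) /=; case: (b) => //=; by rewrite addbC.
have [eX|eX] := boolP (inside X e).
  exists (inl (exist _ e eX)) => //.
  by rewrite in_cut -!(mem_unsplit b) !val_gends /= -in_cut.
have eC : e \in cut X.
  move: eX eA; rewrite /inside !in_cut !inE; case: (gends e false \in X); case: (gends e true \in X) => //.
  by rewrite addbb.
have [b' eb'] : exists b', e = r b'.
  by move: eC; rewrite cX in_set2 => /orP [] /eqP ->; eexists.
have [c' [h1' h2']] := r_end b'.
have bb : b' = ~~ b.
  move: eA; rewrite eb' (in_cut_end _ _ c') h1' [_ (~~ c') \in _]inE (negbTE h2').
  have -> : xend X (r b') = val (d b') by [].
  by rewrite mem_unsplit; case: (b'); case: (b); rewrite ?addbb.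
exists (inr tt); last by rewrite /= -bb.
move: eA; rewrite eb' (in_cut_end _ _ c') h1' [_ (~~ c') \in _]inE (negbTE h2').
have -> : xend X (r b') = val (d b') by [].
rewrite mem_unsplit bb [inr _ \in _]in_cut -!(mem_unsplit b) !val_gends.
have e0 a : xend X (r a) = val (d a) by [].
by rewrite !e0 !mem_unsplit; case: (b) => //; rewrite addbC.
Qed.

Lemma unsplit1 b x : d b != x -> unsplit_side b [set x] = [set val x].
Proof.
move=> dx; apply/setP=> v; rewrite !inE (negbTE dx); case: ifP => vX.
  by rewrite -val_eqE val_insubd vX.
by apply/esym/negP=> /eqP h; have := valP x; rewrite -h vX.
Qed.

(** The ends of the new edge differ, so one of them is not [x]; placing [~: X] with that one keeps
    [x] alone on its side. *)
Lemma star_compl2 x : exists b, [set edge_to b k | k in star x] = star (val x).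
Proof.
have [b db] : exists b, d b != x.
  have [<-|] := eqVneq (d false) x; last by exists false.
  by exists true; rewrite eq_sym d_neq.
by exists b; rewrite cut_compl2 unsplit1.
Qed.

Lemma compl2_good : good_graph K.
Proof.
case: (good) => ll c3 ec _; split.
- case=> [e|[]]; first by rewrite -val_eqE !val_gends ll.
  by rewrite -val_eqE !val_gends; exact: d_neq.
- by move=> x; have [b hb] := star_compl2 x; rewrite -(c3 (val x)) -hb card_imset //; exact: edge_to_inj.
- move=> A A0 AT; rewrite -(card_imset _ (@edge_to_inj false)) cut_compl2.
  apply: ec; first by have [x xA] := set0Pn _ A0; apply/set0Pn; exists (val x); rewrite mem_unsplit.
  by apply: contra AT => /eqP h; apply/eqP/setP=> x; rewrite -(mem_unsplit false) h !in_setT.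
by apply/card_gt0P; exists (d false).
Qed.

Lemma mem_star_compl2 x : exists b, forall k, k \in star x -> edge_to b k \in star (val x).
Proof. by have [b hb] := star_compl2 x; exists b => k kx; rewrite -hb imset_f. Qed.

Lemma compl2_colour : colourable3 K <-> colourable_on X.
Proof.
have c2 : #|cut X| = 2 by rewrite cX cards2 rr.
rewrite (colourable3P compl2_good); split=> [[c hc]|[c hc]].
  exists (fun e => if insub e is Some k then c (inl k) else c (inr tt)) => v vX e f ev fv.
  have hE b k : (if insub (edge_to b k) is Some k' then c (inl k') else c (inr tt)) = c k.
    case: k => [k|[]] /=; first by rewrite valK.
    by rewrite insubF //; apply/negP=> /inside_cut; rewrite r_cut.
  have [b hb] := star_compl2 (exist _ v vX); rewrite -hb in ev fv.
  case/imsetP: ev => k kx ->; case/imsetP: fv => k' kx' ->.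
  by rewrite !hE => /(hc _ (in_setT _) _ _ kx kx') ->.
have ce b k : c (edge_to b k) = c (edge_to false k).
  case: k => //= _; exact: (proper_cut2 good hc c2 (r_cut _) (r_cut _)).
exists (fun k => c (edge_to false k)) => x _ k k' kx kx'.
have [b hb] := mem_star_compl2 x; rewrite -(ce b k) -(ce b k').
by move/(hc _ (valP x) _ _ (hb k kx) (hb k' kx'))/edge_to_inj.
Qed.

(** By parity a matching contains both edges of the 2-cut or neither, so the new edge can inherit
    their membership. It is simply covered because the cut edges have an end off the core. *)
Lemma compl2_array m D : skeleton m D -> core_free D (~: X) ->
  exists2 m' : 'I_3 -> {set gE K}, array m' &
    forall k, mult m' k = if compl2_map k is Some e then mult m e else 1.
Proof.
move=> sk free; have c2 : #|cut X| = 2 by rewrite cX cards2 rr.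
have rm i : (r false \in m i) = (r true \in m i).
  have arr0 : matching_on X (m i) by move=> v _; apply: (sk_array sk); rewrite inE.
  have := odd_matching_cut good arr0; rewrite -(odd_card_cut good) c2.
  have -> : m i :&: cut X = [set e in [set r false; r true] | e \in m i].
    by apply/setP=> e; rewrite cX in_setI inE andbC.
  case h1: (_ \in m i); case h2: (_ \in m i) => //.
    have -> : [set e in [set r false; r true] | e \in m i] = [set r false].
      by apply/setP=> e; rewrite !inE; have [->|_] := eqVneq e (r false); rewrite ?h1 //=; apply/negP=> /andP [/eqP ->]; rewrite h2.
    by rewrite cards1.
  have -> : [set e in [set r false; r true] | e \in m i] = [set r true].
    apply/setP=> e; rewrite !inE; have [->|_] := eqVneq e (r true); rewrite ?h2 ?orbT //.
    by rewrite orbF; apply/negP=> /andP [/eqP ->]; rewrite h1.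
  by rewrite cards1.
have me b k i : (edge_to b k \in m i) = (edge_to false k \in m i).
  by case: k => //= _; case: b => //=; rewrite rm.
exists (fun i => [set k | edge_to false k \in m i]).
  move=> i x _; have [b hb] := star_compl2 x.
  rewrite -(sk_array sk i (in_setT (val x))) -hb -(card_imset _ (@edge_to_inj b)).
  apply: eq_card => e; rewrite [RHS]in_setI; apply/imsetP/andP => [[k]|[ei /imsetP [k kx ek]]].
    by rewrite in_setI inE => /andP [ki kx] ->; rewrite me ki imset_f.
  by exists k; rewrite // in_setI inE -(me b) -ek ei.
case=> [e|[]] /=; first by apply: eq_card => i; rewrite !inE.
apply/eqP/mult1P; have [c [h1 h2]] := r_end true.
have vX : gends (r true) (~~ c) \in ~: X by rewrite inE.
have [ll _ _ _] := good.
have /eqP/mult1P [l hl hu] := off_skeleton good sk (free _ ^~ vX) (star_end ll (r true) (~~ c)).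
by exists l; rewrite ?inE // => j; rewrite inE => /hu.
Qed.

Lemma compl2_completion : 0 < #|~: X| -> @completion H X K (@compl2_map H X).
Proof.
move=> X1; split.
- exact: compl2_good.
- by rewrite card_sig; have := cardsC X; have -> : #|[pred x | x \in X]| = #|X| by []; move: X1; nlia.
- exact: compl2_colour.
- exact: compl2_array.
- by case=> [e|[]] [f|[]] g //= [<-] [/val_inj ->].
by move=> e eX; exists (inl (exist _ e eX)).
Qed.

End Compl2.

(** * Reconstruction by sums *)

(** Grafting of sum trees: a leaf [H] is replaced by a reconstruction of [H]. Lists are compared up
    to permutation since the leaf may sit in either summand. *)
Lemma recon_subst G t : recon G t -> forall H l s, recon H l ->
  Permutation.Permutation t (H :: s) -> recon G (l ++ s).
Proof.
have split_in (H : graph) (sH sK s : seq graph) : List.In H sH ->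
    Permutation.Permutation (sH ++ sK) (H :: s) ->
    exists s', Permutation.Permutation sH (H :: s') /\ Permutation.Permutation (s' ++ sK) s.
  move=> hin hp; have [a [b hab]] := List.in_split _ _ hin.
  exists (a ++ b); split; first by rewrite hab; apply/Permutation.Permutation_sym/Permutation.Permutation_middle.
  apply: (@Permutation.Permutation_cons_inv _ _ _ H).
  apply: Permutation.perm_trans hp; rewrite hab -[app a _]/(a ++ H :: b) -!catA.
  exact: (Permutation.Permutation_middle a (b ++ sK) H).
have in_cat (H : graph) (sH sK s : seq graph) : Permutation.Permutation (sH ++ sK) (H :: s) ->
    List.In H sH \/ List.In H sK.
  move=> hp; apply: List.in_app_or; apply: Permutation.Permutation_in (Permutation.Permutation_sym hp) _.
  by left.
have perm_l (s' sK s l : seq graph) : Permutation.Permutation (s' ++ sK) s ->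
    Permutation.Permutation ((l ++ s') ++ sK) (l ++ s).
  by move=> hp; rewrite -catA; apply: Permutation.Permutation_app_head.
have perm_r (s' sH s l : seq graph) : Permutation.Permutation (s' ++ sH) s ->
    Permutation.Permutation (sH ++ (l ++ s')) (l ++ s).
  move=> hp; apply: Permutation.perm_trans (perm_l _ _ _ l hp).
  exact: Permutation.Permutation_app_comm.
elim=> {G t} [G|G G' t _ IH iso|G t t' _ IH hp|H K sH sK e f sg rH IHH rK IHK cH cK tH tK
  |H K sH sK u v hu hv beta rH IHH rK IHK cH cK tH tK bb] J l s rJ hJ.
- have [eJ es] := Permutation.Permutation_length_1_inv hJ.
  by rewrite eJ in rJ; rewrite es cats0.
- by apply: rc_iso iso; apply: IH rJ hJ.
- by apply: IH rJ _; apply: Permutation.perm_trans hp hJ.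
- case: (in_cat _ _ _ _ hJ) => hin.
    have [s' [h1 h2]] := split_in _ _ _ _ hin hJ.
    by apply: rc_perm (perm_l _ _ _ l h2); apply: rc_sum2 => //; apply: IHH rJ h1.
  have hJ' := Permutation.perm_trans (Permutation.Permutation_app_comm sK sH) hJ.
  have [s' [h1 h2]] := split_in _ _ _ _ hin hJ'.
  by apply: rc_perm (perm_r _ _ _ l h2); apply: rc_sum2 => //; apply: IHK rJ h1.
case: (in_cat _ _ _ _ hJ) => hin.
  have [s' [h1 h2]] := split_in _ _ _ _ hin hJ.
  by apply: rc_perm (perm_l _ _ _ l h2); apply: rc_sum3 => //; apply: IHH rJ h1.
have hJ' := Permutation.perm_trans (Permutation.Permutation_app_comm sK sH) hJ.
have [s' [h1 h2]] := split_in _ _ _ _ hin hJ'.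
by apply: rc_perm (perm_r _ _ _ l h2); apply: rc_sum3 => //; apply: IHK rJ h1.
Qed.

Lemma inj_surj_bij (A B : finType) (f : A -> B) :
  injective f -> (forall y, exists x, f x = y) -> bijective f.
Proof.
move=> fI fS; apply: inj_card_bij fI _.
have -> : #|B| = #|f @: [set: A]|.
  by rewrite -cardsT; apply: eq_card => y; rewrite inE; have [x <-] := fS y; rewrite imset_f.
by rewrite -cardsT leq_imset_card.
Qed.

Section Sum3.
Variable H : graph.
Hypothesis good : good_graph H.

Lemma dart_contract (S : {set gV H})
    (d : darts (None : gV (contract S [set e | inside S e]))) :
  gends (val (val d).1) (val d).2 \in S /\ gends (val (val d).1) (~~ (val d).2) \notin S.
Proof.
case: d => [[k b] h] /=; have hS : gends (val k) b \in S.
  by move: h => /= /eqP; case: insubP => // /negbNE.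
by have := valP k; rewrite inE (insideE _ _ b) hS.
Qed.

Lemma dart_contract_ex (S : {set gV H}) e : e \in cut S ->
  exists d : darts (None : gV (contract S [set e | inside S e])), val (val d).1 = e.
Proof.
move=> eS; have [k hk] : exists k : gE (contract S [set e | inside S e]), val k = e.
  by apply: contract_edge; apply/negP=> /inside_cut; rewrite eS.
have [b [bS _]] := cutP eS.
have h : gends (k, b).1 (k, b).2 == (None : gV (contract S [set e | inside S e])).
  by rewrite /= [val k]hk insubF // bS.
by exists (exist _ (k, b) h).
Qed.

Lemma dart_contract_inj (S : {set gV H}) :
  injective (fun d : darts (None : gV (contract S [set e | inside S e])) => val (val d).1).
Proof.
move=> d d' h; have [h1 h2] := dart_contract d; have [h3 h4] := dart_contract d'.
apply: val_inj; move: h h1 h2 h3 h4; case: (val d) => k b; case: (val d') => k' b' /= /val_inj ->.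
by case: b; case: b' => //= -> // /negbTE ->.
Qed.

Variable S : {set gV H}.
Let K1 := contract S [set e | inside S e].
Let K2 := contract (~: S) [set e | inside (~: S) e].

(** Away from the new vertices each vertex has a unique preimage. A cut edge occurs in both
    completions, and [beta] has to match its two copies for the sum to give it back. *)
Lemma sum3_giso (hu : forall d : darts (None : gV K1), other (val d) != None)
    (hv : forall d : darts (None : gV K2), other (val d) != None) beta :
  S != set0 -> ~: S != set0 ->
  (forall d, val (val (beta d)).1 = val (val d).1) ->
  giso (@sum3 K1 K2 None None hu hv beta) H.
Proof.
move=> S0 S0' hbeta.
have ex1 (x : gV K1) : exists v, (insub v : gV K1) == x.
  by have [v hv'] := uncontract_surj S0 x; exists v; apply/eqP.
have ex2 (x : gV K2) : exists v, (insub v : gV K2) == x.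
  by have [v hv'] := uncontract_surj S0' x; exists v; apply/eqP.
have p1 x : (insub (xchoose (ex1 x)) : gV K1) = x by apply/eqP/(xchooseP (ex1 x)).
have p2 x : (insub (xchoose (ex2 x)) : gV K2) = x by apply/eqP/(xchooseP (ex2 x)).
have q1 x : x != None -> xchoose (ex1 x) \notin S.
  by rewrite -{1}(p1 x); case: insubP.
have q2 x : x != None -> xchoose (ex2 x) \in S.
  by rewrite -{1}(p2 x); case: insubP => // u; rewrite inE negbK.
have r1 v : v \notin S -> xchoose (ex1 (insub v)) = v.
  move=> vS; have := p1 (insub v); rewrite (insubT (fun v => v \notin S) vS).
  by case: insubP => // u _ <- [->].
have r2 v : v \in S -> xchoose (ex2 (insub v)) = v.
  move=> vS; have vS' : v \notin ~: S by rewrite inE vS.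
  have := p2 (insub v); rewrite (insubT (fun v => v \notin ~: S) vS').
  by case: insubP => // u _ <- [->].
pose fV (x : gV (@sum3 K1 K2 None None hu hv beta)) : gV H :=
  match x with inl y => xchoose (ex1 (val y)) | inr y => xchoose (ex2 (val y)) end.
pose fE (k : gE (@sum3 K1 K2 None None hu hv beta)) : gE H :=
  match k with inl (inl y) => val (val y) | inl (inr y) => val (val y) | inr d => val (val d).1 end.
have n1 (y : {x : gE K1 | noinc (None : gV K1) x}) b : gends (val (val y)) b \notin S.
  by have := noinc_end (valP y) b; rewrite /=; case: insubP.
have n2 (y : {x : gE K2 | noinc (None : gV K2) x}) b : gends (val (val y)) b \in S.
  by have := noinc_end (valP y) b; rewrite /=; case: insubP => // u; rewrite inE negbK.
exists fV, fE; split.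
- apply: inj_surj_bij.
    move=> [x|x] [y|y] /= h.
    + by congr inl; apply: val_inj; rewrite -(p1 (val x)) h p1.
    + by have := q1 _ (valP x); rewrite h q2 // (valP y).
    + by have := q1 _ (valP y); rewrite -h q2 // (valP x).
    by congr inr; apply: val_inj; rewrite -(p2 (val x)) h p2.
  move=> v; have [vS|vS] := boolP (v \in S).
    have h : (insub v : gV K2) != None by rewrite insubT // inE vS.
    by exists (inr (exist (fun x : gV K2 => x != None) _ h)); rewrite /= r2.
  have h : (insub v : gV K1) != None by rewrite insubT.
  by exists (inl (exist (fun x : gV K1 => x != None) _ h)); rewrite /= r1.
- apply: inj_surj_bij.
    move=> [[x|x]|x] [[y|y]|y] h.
    + by congr (inl (inl _)); apply/val_inj/val_inj.
    + have {}h : val (val x) = val (val y) := h.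
      by have := n1 x false; rewrite h n2.
    + have {}h : val (val x) = val (val y).1 := h.
      have [h1 _] := dart_contract y; rewrite -h in h1.
      by have := n1 x (val y).2; rewrite h1.
    + have {}h : val (val x) = val (val y) := h.
      by have := n1 y false; rewrite -h n2.
    + by congr (inl (inr _)); apply/val_inj/val_inj.
    + have {}h : val (val x) = val (val y).1 := h.
      have [_ h1] := dart_contract y; rewrite -h in h1.
      by have := n2 x (~~ (val y).2); rewrite (negbTE h1).
    + have {}h : val (val x).1 = val (val y) := h.
      have [h1 _] := dart_contract x; rewrite h in h1.
      by have := n1 y (val x).2; rewrite h1.
    + have {}h : val (val x).1 = val (val y) := h.
      have [_ h1] := dart_contract x; rewrite h in h1.
      by have := n2 y (~~ (val x).2); rewrite (negbTE h1).
    by congr inr; apply: dart_contract_inj.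
  move=> e; have [eS|eS] := boolP (inside S e).
    have [k hk] : exists k : gE K2, val k = e.
      by apply: contract_edge; move: eS; rewrite /inside !inE => /andP [-> _].
    have h : noinc (None : gV K2) k.
      apply/forallP=> b; rewrite /= [val k]hk insubT // inE negbK.
      by move: eS; rewrite (insideE _ _ b) => /andP [].
    by exists (inl (inr (exist _ k h))).
  have [k hk] := contract_edge eS.
  have [eC|eC] := boolP (e \in cut S).
    by have [d hd] := dart_contract_ex eC; exists (inr d).
  have h : noinc (None : gV K1) k.
    apply/forallP=> b; rewrite /= [val k]hk insubT //.
    apply: contra eS => bS; rewrite (insideE _ _ b) bS.
    by move: eC; rewrite (in_cut_end _ _ b) bS /= negbK.
  by exists (inl (inl (exist _ k h))).
move=> [[x|x]|d].
- by left; split; apply: esym; [exact: (r1 _ (n1 x false))|exact: (r1 _ (n1 x true))].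
- by left; split; apply: esym; [exact: (r2 _ (n2 x false))|exact: (r2 _ (n2 x true))].
have [h1 h2] := dart_contract d; have [h3 h4] := dart_contract (beta d).
pose e := val (val d).1; pose b := (val d).2; pose b' := (val (beta d)).2.
have h3' : gends e b' \in ~: S by move: h3; rewrite hbeta.
have bb : b' = ~~ b.
  have nb : b' != b by apply: contraTneq h3' => ->; rewrite inE h1.
  by move: nb; case: (b); case: (b').
have fe : fE (inr d) = e := erefl.
have f0 : fV (gends (inr d : gE (sum3 hu hv beta)) false) = gends e (~~ b) := r1 _ h2.
have f1 : fV (gends (inr d : gE (sum3 hu hv beta)) true) = gends e b.
  have h : gends (val (val (beta d)).1) (~~ (val (beta d)).2) = gends e b.
    by rewrite hbeta -/b' bb negbK.
  by rewrite -h; apply: r2; rewrite h.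
by rewrite fe f0 f1; case: (b); [left|right].
Qed.

Lemma sum3_recon : S != set0 -> ~: S != set0 -> #|cut S| = 3 -> recon H [:: K1; K2].
Proof.
move=> S0 S0' S3; have S3' : #|cut (~: S)| = 3 by rewrite cutC.
have g1 : good_graph K1 := contract_good good S0 S3.
have g2 : good_graph K2 := contract_good good S0' S3'.
have hu : forall d : darts (None : gV K1), other (val d) != None.
  move=> d; have [_] := dart_contract d; rewrite /other /= => h.
  by rewrite insubT.
have hv : forall d : darts (None : gV K2), other (val d) != None.
  move=> d; have [_] := dart_contract d; rewrite /other /= => h.
  by rewrite insubT.
have ex (d : darts (None : gV K1)) : exists d' : darts (None : gV K2),
    val (val d').1 == val (val d).1.
  have [h1 h2] := dart_contract d.
  have [|d' hd'] := @dart_contract_ex (~: S) (val (val d).1).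
    by rewrite cutC (in_cut_end _ _ (val d).2) h1 (negbTE h2).
  by exists d'; apply/eqP.
have ex' (d : darts (None : gV K2)) : exists d' : darts (None : gV K1),
    val (val d').1 == val (val d).1.
  have [h1 h2] := dart_contract d.
  have [|d' hd'] := @dart_contract_ex S (val (val d).1).
    by rewrite -cutC (in_cut_end _ _ (val d).2) h1 (negbTE h2).
  by exists d'; apply/eqP.
pose beta d := xchoose (ex d).
have hb d : val (val (beta d)).1 = val (val d).1 by apply/eqP/(xchooseP (ex d)).
have hb' d : val (val (xchoose (ex' d))).1 = val (val d).1 by apply/eqP/(xchooseP (ex' d)).
have bB : bijective beta.
  exists (fun d => xchoose (ex' d)) => d; apply: dart_contract_inj.
    by rewrite hb' hb.
  by rewrite hb hb'.
apply: rc_iso (sum3_giso hu hv S0 S0' hb).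
have [c1 t1] := (good_graphP _).1 g1; have [c2 t2] := (good_graphP _).1 g2.
by apply: (@rc_sum3 K1 K2 [:: K1] [:: K2]) => //; apply: rc_leaf.
Qed.

End Sum3.

Section Sum2.
Variable H : graph.
Hypothesis good : good_graph H.
Variables (X : {set gV H}) (r : bool -> gE H).
Hypotheses (hr1 : forall b, xend X (r b) \in X) (hr2 : forall b, xend (~: X) (r b) \in ~: X).
Hypotheses (cX : cut X = [set r false; r true]) (rr : r false != r true).

Lemma sum2_giso : giso (@sum2 (compl2 hr1) (compl2 hr2) (inr tt) (inr tt) false) H.
Proof.
have rC b : r b \in cut X by rewrite cX in_set2; case: b; rewrite eqxx ?orbT.
have rI : injective r by move=> [] [] // /eqP; rewrite ?[r true == _]eq_sym (negbTE rr).
pose fV (x : gV (@sum2 (compl2 hr1) (compl2 hr2) (inr tt) (inr tt) false)) : gV H :=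
  match x with inl y => val y | inr y => val y end.
(* The value of [edge_to] at the new edge is a default that is never reached, since [sum2] deletes
   that edge from both summands. *)
pose fE (k : gE (@sum2 (compl2 hr1) (compl2 hr2) (inr tt) (inr tt) false)) : gE H :=
  match k with
  | inl (inl y) => edge_to true (val y)
  | inl (inr y) => edge_to true (val y)
  | inr b => r b end.
exists fV, fE; split.
- apply: inj_surj_bij.
    move=> [x|x] [y|y] /= h.
    + by congr inl; apply: val_inj.
    + by have hv : val x = val y := h; have := valP y; rewrite -hv inE (valP x).
    + by have hv : val x = val y := h; have := valP x; rewrite hv inE (valP y).
    by congr inr; apply: val_inj.
  move=> v; have [vX|vX] := boolP (v \in X); first by exists (inl (exist _ v vX)).
  have vX' : v \in ~: X by rewrite inE.
  by exists (inr (exist _ v vX')).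
- apply: inj_surj_bij.
    have in2 (e : {e | inside (~: X) e}) (f : {e | inside X e}) : val e = val f -> False.
      by have := valP e; have := valP f; rewrite /inside => /andP [h _] + ef; rewrite ef !inE h.
    have no1 (e : {e | inside X e}) b : val e = r b -> False.
      by move=> h; have := inside_cut (valP e); rewrite h rC.
    have no2 (e : {e | inside (~: X) e}) b : val e = r b -> False.
      by move=> h; have := inside_cut (valP e); rewrite h cutC rC.
    move=> [[[[e|[]] he]|[[e|[]] he]]|b] [[[[f|[]] hf]|[[f|[]] hf]]|b'] //= h.
    + by congr (inl (inl _)); apply: val_inj => /=; congr inl; apply: val_inj.
    + by case: (in2 f e).
    + by case: (no1 e b').
    + by case: (in2 e f).
    + by congr (inl (inr _)); apply: val_inj => /=; congr inl; apply: val_inj.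
    + by case: (no2 e b').
    + by case: (no1 f b).
    + by case: (no2 f b).
    by congr inr; apply: rI.
  move=> e; have [eX|eX] := boolP (inside X e).
    have h : (inl (exist _ e eX) : gE (compl2 hr1)) != inr tt by [].
    by exists (inl (inl (exist (fun k : gE (compl2 hr1) => k != inr tt) _ h))).
  have [eC|eC] := boolP (e \in cut X).
    by move: eC; rewrite cX in_set2 => /orP [] /eqP ->; [exists (inr false)|exists (inr true)].
  have eX' : inside (~: X) e.
    by move: eX eC; rewrite /inside in_cut !inE; do 2 case: (_ \in X).
  have h : (inl (exist _ e eX') : gE (compl2 hr2)) != inr tt by [].
  by exists (inl (inr (exist (fun k : gE (compl2 hr2) => k != inr tt) _ h))).
move=> [[[[e|[]] he]|[[e|[]] he]]|b] //.
- by left; split; apply: esym; [exact: (val_gends (inl e : gE (compl2 hr1)) false)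
    |exact: (val_gends (inl e : gE (compl2 hr1)) true)].
- by left; split; apply: esym; [exact: (val_gends (inl e : gE (compl2 hr2)) false)
    |exact: (val_gends (inl e : gE (compl2 hr2)) true)].
have v1 : fV (gends (inr b : gE (sum2 _ _ _)) false) = xend X (r b) :=
  val_gends (inr tt : gE (compl2 hr1)) b.
have v2 : fV (gends (inr b : gE (sum2 _ _ _)) true) = xend (~: X) (r b).
  by have := val_gends (inr tt : gE (compl2 hr2)) b; rewrite -{1}[b]addbF; apply.
rewrite v1 v2 /xend !inE; have := rC b; rewrite in_cut.
have -> : fE (inr b) = r b by [].
by case: (_ \in X); case: (_ \in X) => //= _; [left|right].
Qed.

End Sum2.

(** Beyond this point 2-cuts and 3-cuts are treated alike. The map [phi] and the list [s] are
    quantified after the completions, so the same step applies within any decomposition. *)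
Lemma decomposition_step (H : graph) (X : {set gV H}) : good_graph H ->
  indep_cut X -> 1 < #|X| -> 1 < #|~: X| -> #|cut X| <= 3 ->
  exists (K1 K2 : graph) (psi1 : gE K1 -> option (gE H)) (psi2 : gE K2 -> option (gE H)),
  [/\ completion X psi1, completion (~: X) psi2, recon H [:: K1; K2] &
    forall G (phi : gE H -> option (gE G)) s, decomp (existT _ H phi :: s) ->
      decomp (existT (fun K => gE K -> option (gE G)) K1 (fun k => obind phi (psi1 k))
           :: existT (fun K => gE K -> option (gE G)) K2 (fun k => obind phi (psi2 k)) :: s)].
Proof.
move=> good iX X1 X1' X3; have c2 := card_gt1_cut good X1 X1'.
have [_ _ ind] := iX.
have [e3|e2] : #|cut X| = 3 \/ #|cut X| = 2 by nlia.
  exists (compl3 X), (compl3 (~: X)), (@contract_map H _ _), (@contract_map H _ _); split.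
  - exact: compl3_completion.
  - by apply: compl3_completion; rewrite ?setCK ?cutC.
  - apply: sum3_recon; rewrite ?cutC // -card_gt0 ?setCK; nlia.
  by move=> G phi s hs; apply: dec_cut3.
have /cards2P [r0 [r1 [rr cX]]] : #|cut X| == 2 by rewrite e2.
pose r b := if b then r1 else r0.
have rC b : r b \in cut X by rewrite cX in_set2 /r; case: b; rewrite eqxx ?orbT.
have hr1 b : xend X (r b) \in X.
  by have := rC b; rewrite in_cut /xend; case: ifP.
have hr2 b : xend (~: X) (r b) \in ~: X.
  by have := rC b; rewrite -cutC in_cut /xend; case: ifP.
exists (compl2 hr1), (compl2 hr2), (@compl2_map H X), (@compl2_map H (~: X)).
have p1 : @completion H X (compl2 hr1) (@compl2_map H X).
  by apply: compl2_completion => //; nlia.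
have p2 : @completion H (~: X) (compl2 hr2) (@compl2_map H (~: X)).
  by apply: compl2_completion; rewrite ?cutC ?setCK //; nlia.
split=> //.
  apply: (rc_iso _ (sum2_giso hr1 hr2 cX rr)).
  have [d1 t1] := (good_graphP _).1 (cp_good p1); have [d2 t2] := (good_graphP _).1 (cp_good p2).
  by apply: (@rc_sum2 _ _ [:: _] [:: _]) => //; apply: rc_leaf.
by move=> G phi s hs; apply: dec_cut2.
Qed.

(** * The decomposition *)

Section Defect.
Variable G : graph.
Hypothesis good : good_graph G.

Lemma perfect_matchingE M : perfect_matching M <-> matching_on [set: gV G] M.
Proof.
have [ll _ _ _] := good.
split=> h v; first by move=> _; rewrite -(ddeg_star ll).
by rewrite (ddeg_star ll) h ?inE.
Qed.

Lemma array3_array A : array3 A -> exists m : 'I_3 -> {set gE G},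
  array m /\ forall e, cov A e = mult m e.
Proof.
case=> A3 hA; pose m i := enum_val (cast_ord (esym A3) i).
have mI : injective m by move=> i j /enum_val_inj /cast_ord_inj.
have mA : A = m @: setT.
  apply/eqP; rewrite eq_sym eqEcard card_imset // cardsT card_ord A3 leqnn andbT.
  by apply/subsetP=> _ /imsetP [i _ ->]; apply: enum_valP.
exists m; split=> [i|e].
  by apply/perfect_matchingE/hA; apply: enum_valP.
rewrite /cov /mult -(card_imset _ mI) mA; apply: eq_card => M.
rewrite inE; apply/andP/imsetP => [[/imsetP [i _ ->] ei]|[i]]; first by exists i; rewrite ?inE.
by rewrite inE => ei ->; rewrite imset_f.
Qed.

Lemma array_array3 (m : 'I_3 -> {set gE G}) : array m -> injective m ->
  array3 (m @: setT) /\ forall e, cov (m @: setT) e = mult m e.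
Proof.
move=> arr mI; split; first split.
- by rewrite card_imset // cardsT card_ord.
- by move=> _ /imsetP [i _ ->]; apply/perfect_matchingE/arr.
move=> e; rewrite /cov /mult -(card_imset _ mI); apply: eq_card => M.
rewrite inE; apply/andP/imsetP => [[/imsetP [i _ ->] ei]|[i]]; first by exists i; rewrite ?inE.
by rewrite inE => ei ->; rewrite imset_f.
Qed.

Lemma uncovered_misses A (m : 'I_3 -> {set gE G}) :
  (forall e, cov A e = mult m e) -> uncovered A = misses m.
Proof. by move=> h; apply/setP=> e; rewrite !inE h. Qed.

Lemma defect3_uncolourable : defect G 3 -> ~ colourable3 G.
Proof.
have [_ _ _ V0] := good; move=> [_ hmin] /(colourable3P good) [c hc].
pose m i := [set e | c e == i].
have arr : array m by move=> i; apply: proper_class.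
have mI : injective m.
  move=> i j ij; have [v _] := card_gt0P V0.
  have [e ei ev] := matching_edge (arr i) (in_setT v).
  have ej := ei; rewrite ij in ej.
  by move: ei ej; rewrite !in_set => /eqP <- /eqP.
have [a3 hcov] := array_array3 arr mI; have := hmin _ a3.
rewrite (uncovered_misses hcov); suff -> : misses m = set0 by rewrite cards0.
apply/setP=> e; rewrite mem_misses in_set0; apply/negP=> /forallP /(_ (c e)).
by rewrite inE eqxx.
Qed.

(** An array with fewer than three misses would, by [skeletonI], have exactly three. Hence any
    skeleton in an uncolourable graph is optimal. *)
Lemma skeleton_defect m D : ~ colourable3 G -> skeleton m D ->
  defect G 3 /\ hexcore G [set e | mult m e != 1].
Proof.
move=> ncol sk; have arr := sk_array sk.
have [m3 _] := skeletonI good arr ncol (sk_misses sk).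
have mI : injective m.
  move=> i j ij; apply/eqP/negPn/negP=> nij.
  by have := sk_mem sk i j; rewrite -ij (sk_mem sk) eqxx eq_sym (negbTE nij).
have [a3 hcov] := array_array3 arr mI.
have u3 : #|uncovered (m @: setT)| = 3 by rewrite (uncovered_misses hcov).
have hmin (A : {set {set gE G}}) : array3 A -> 3 <= #|uncovered A|.
  move=> /array3_array [m' [arr' hcov']]; rewrite (uncovered_misses hcov') leqNgt.
  apply/negP=> lt3; have [|h _] := skeletonI good arr' ncol; first by apply: ltnW.
  by rewrite h in lt3.
split; first by split=> //; exists (m @: setT).
exists (m @: setT); split; last by apply/setP=> e; rewrite !inE hcov.
by split=> // A /hmin; rewrite u3.
Qed.

Lemma hexcore_skeleton C : defect G 3 -> hexcore G C ->
  exists m D, skeleton m D /\ C = [set e | mult m e != 1].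
Proof.
move=> df [A [[a3 opt] <-]]; have ncol := defect3_uncolourable df.
have [m [arr hcov]] := array3_array a3.
have [[A0 [a0 u0]] _] := df; have := opt _ a0; rewrite u0 (uncovered_misses hcov) => le3.
have [_ [D sk]] := skeletonI good arr ncol le3.
by exists m, D; split=> //; apply/setP=> e; rewrite !inE hcov.
Qed.

End Defect.

Lemma card3_set (T : finType) (A : {set T}) : #|A| = 3 ->
  exists a b c, [&& a != b, b != c & c != a] /\ A = [set a; b; c].
Proof.
move=> A3; have [a aA] : exists a, a \in A by apply/card_gt0P; rewrite A3.
have hb := cardsD1 a A; rewrite aA A3 in hb.
have [b bA] : exists b, b \in A :\ a by apply/card_gt0P; nlia.
have hc := cardsD1 b (A :\ a); rewrite bA in hc.
have [c cA] : exists c, c \in A :\ a :\ b by apply/card_gt0P; nlia.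
move: bA cA; rewrite !in_setD1 => /andP [ba bA] /and3P [cb ca cA].
have ab : a != b by rewrite eq_sym.
have bc : b != c by rewrite eq_sym.
exists a, b, c; rewrite ab bc ca; split=> //.
apply/eqP; rewrite eq_sym eqEcard A3 !subUset !sub1set aA bA cA /=.
by rewrite setUC cardsU1 cards2 !inE negb_or ca cb ab.
Qed.

(** * Factors from which no core-free set can be split off *)

Section Irreducible.
Variable G : graph.
Hypothesis good : good_graph G.
Hypothesis ncol : ~ colourable3 G.
Variables (m : 'I_3 -> {set gE G}) (D : 'I_3 -> gE G).
Hypothesis sk : skeleton m D.
Hypothesis irred : forall W, core_free D W -> 1 < #|W| -> #|cut W| <= 3 -> False.

Lemma irreducible_triangle X : #|cut X| <= 3 -> 1 < #|X| -> 1 < #|~: X| ->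
  exists Z i, (Z = X \/ Z = ~: X) /\ triangle_side m D Z i.
Proof.
move=> h3 h1 h2; case: (cut_cases good ncol sk h3 h1 h2) => // -[W [a b c]].
by case: (irred a b c).
Qed.

(** Three distinct edges come from pairwise adjacency. The degree sum [9] minus the three cut edges
    leaves room for exactly three inner edges, so there are no parallel ones. *)
Lemma triangle_inside Z i a b c : triangle_side m D Z i -> Z = [set a; b; c] ->
  [&& a != b, b != c & c != a] -> exists t1 t2 t3,
  [&& joins t1 a b, joins t2 b c & joins t3 c a] /\ [set e | inside Z e] = [set t1; t2; t3].
Proof.
have [ll c3 _ _] := good; move=> tZ eZ /and3P [ab bc ca].
have aZ : a \in Z by rewrite eZ !inE eqxx.
have bZ : b \in Z by rewrite eZ !inE eqxx orbT.
have cZ : c \in Z by rewrite eZ !inE eqxx orbT.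
have both (x y : gV G) (t : gE G) : x != y -> t \in star x -> t \in star y ->
    joins t x y /\ forall z, t \in star z -> (z == x) || (z == y).
  move=> xy /starP [p hp] /starP [q hq].
  have pq : q = ~~ p.
    have : p != q by apply: contraNneq xy => pq; rewrite -hp -hq pq.
    by case: (p); case: (q).
  split; first by rewrite /joins; move: hp hq; rewrite pq; case: p {pq} => /= -> ->; rewrite !eqxx ?orbT.
  move=> z /starP [s hs]; rewrite -hs -hp -hq pq !ends_neq //.
  by case: (s); case: (p).
have [t1 /andP [t1a t1b]] := triangle_joins good tZ aZ bZ ab.
have [t2 /andP [t2b t2c]] := triangle_joins good tZ bZ cZ bc.
have [t3 /andP [t3c t3a]] := triangle_joins good tZ cZ aZ ca.
have [j1 h1] := both _ _ _ ab t1a t1b; have [j2 h2] := both _ _ _ bc t2b t2c.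
have [j3 h3] := both _ _ _ ca t3c t3a.
exists t1, t2, t3; rewrite j1 j2 j3; split=> //.
have t12 : t1 != t2.
  by apply: contraTneq t2c => <-; apply/negP=> /h1; rewrite (negbTE ca) eq_sym (negbTE bc).
have t23 : t2 != t3.
  by apply: contraTneq t3a => <-; apply/negP=> /h2; rewrite (negbTE ab) eq_sym (negbTE ca).
have t31 : t3 != t1.
  by apply: contraTneq t1b => <-; apply/negP=> /h3; rewrite (negbTE bc) eq_sym (negbTE ab).
have ins t x y : x \in Z -> y \in Z -> joins t x y -> inside Z t.
  by move=> xZ yZ /orP [] /andP [/eqP h /eqP h']; rewrite /inside h h' xZ yZ.
apply/eqP; rewrite eq_sym eqEcard !subUset !sub1set !in_set.
rewrite (ins t1 a b) // (ins t2 b c) // (ins t3 c a) //=.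
have := sum_star ll setT Z; rewrite setTI (triangle_cut good tZ) (eq_bigr (fun=> 3)).
  rewrite sum_nat_const (ts_card tZ) => cnt.
  rewrite setUC cardsU1 cards2 !inE negb_or t31 [t3 == t2]eq_sym t23 t12 /=.
  have -> : #|[set e | inside Z e]| = #|[set e in setT | inside Z e]|.
    by congr #|pred_of_set _|; apply/setP=> e; rewrite !in_set.
  by move: cnt; nlia.
by move=> v _; rewrite setTI c3.
Qed.

Lemma triangle_contract_cyc_conn4 Z i : triangle_side m D Z i ->
  cyc_conn (contract Z [set e | inside Z e]) 4.
Proof.
move=> tZ; have Z3 := triangle_cut good tZ.
have Z0 : Z != set0 by rewrite -card_gt0 (ts_card tZ).
apply: cyc_conn4I; first exact: contract_good.
move=> A A1 A1'; rewrite ltnNge; apply/negP=> h3.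
wlog NA : A A1 A1' h3 / None \in A.
  move=> hw; have [NA|NA] := boolP (None \in A); first exact: (hw A).
  by apply: (hw (~: A)); rewrite ?setCK ?cutC ?in_setC.
have sZ := sub_uncontract NA.
(* The side with the new vertex has another vertex, so it lifts to a set of more than three
   vertices. The triangle bounded by this cut is therefore the opposite side, disjoint from [Z]. *)
have [[v|] vA vN] : exists2 x, x \in A & x != None.
- have [x [y [xA yA xy]]] := card_gt1P A1.
  have [xN|] := eqVneq x None; last by exists x.
  by exists y => //; rewrite -xN eq_sym.
- have card4 : 3 < #|uncontract A|.
    rewrite -(ts_card tZ); apply: proper_card; apply/properP; split=> //.
    by exists (val v); [rewrite inE valK|exact: (valP v)].
  have [] := @irreducible_triangle (uncontract A).
  + by rewrite -card_cut_contract.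
  + by apply: leq_trans card4.
  + by rewrite -uncontractC; apply: leq_trans A1' (card_uncontract Z0 _).
  move=> Z' [j [[e|e] tZ']]; first by have := ts_card tZ'; rewrite e; move: card4; nlia.
  apply: ncol; apply: (disjoint_triangles good sk tZ tZ').
  rewrite e -setI_eq0 -subset0; apply/subsetP=> x; rewrite !in_setI in_setC.
  by case/andP=> /(subsetP sZ) ->.
by rewrite eqxx in vN.
Qed.

Lemma irreducible_factor C : C = [set e | mult m e != 1] -> ~ cyc_conn G 4 ->
  exists (a b c : gV G) (t1 t2 t3 : gE G),
    [/\ [&& a != b, b != c & c != a],
        [&& joins t1 a b, joins t2 b c & joins t3 c a],
        [set a; b; c] :&: touched C != set0 &
        cyc_conn (contract [set a; b; c] [set t1; t2; t3]) 4].
Proof.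
move=> eC ncyc; have [ll _ _ _] := good.
have [//|[X [X1 X1' X3]]] := cyc_conn4_or_cut good.
have [Z [i [_ tZ]]] := irreducible_triangle X3 X1 X1'.
have [a [b [c [abc eZ]]]] := card3_set (ts_card tZ).
have [t1 [t2 [t3 [hj eI]]]] := triangle_inside tZ eZ abc.
exists a, b, c, t1, t2, t3; split=> //; last first.
  by rewrite -eI -eZ; apply: triangle_contract_cyc_conn4 tZ.
have /card_gt0P [j] : 0 < #|~: [set i]| by rewrite cardsC1 card_ord.
rewrite !inE => ji; have : D j \in cut Z by rewrite (ts_mem tZ).
case/cutP=> p [pZ _]; apply/set0Pn; exists (gends (D j) p).
rewrite in_setI -eZ pZ inE; apply/exists_inP; exists (D j).
  by rewrite eC inE (mult_skeleton sk).
by apply/existsP; exists p.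
Qed.

End Irreducible.

(** * Repeated splitting, keeping decomposition and reconstruction in step *)

Definition stage (G : graph) (s : seq (factor G)) :=
  decomp s /\ recon G (map (fun F => projT1 F) s).

Definition mkfactor (G K : graph) (psi : gE K -> option (gE G)) : factor G :=
  existT (fun K => gE K -> option (gE G)) K psi.

Lemma stage_perm (G : graph) (s s' : seq (factor G)) :
  stage s -> Permutation.Permutation s s' -> stage s'.
Proof.
case=> h1 h2 p; split; first exact: dec_perm p.
by apply: rc_perm h2 _; apply: (Permutation.Permutation_map _ p).
Qed.

Lemma stage_step (G H : graph) (phi : gE H -> option (gE G)) s (X : {set gV H}) :
  good_graph H -> indep_cut X -> 1 < #|X| -> 1 < #|~: X| -> #|cut X| <= 3 ->
  stage (mkfactor phi :: s) ->
  exists K1 K2 (psi1 : gE K1 -> option (gE H)) (psi2 : gE K2 -> option (gE H)),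
  [/\ completion X psi1, completion (~: X) psi2 &
    stage (mkfactor (fun k => obind phi (psi1 k)) ::
           mkfactor (fun k => obind phi (psi2 k)) :: s)].
Proof.
move=> good iX X1 X1' X3 [h1 h2].
have [K1 [K2 [psi1 [psi2 [c1 c2 rc dc]]]]] := decomposition_step good iX X1 X1' X3.
exists K1, K2, psi1, psi2; split=> //; split; first exact: dc.
exact: (recon_subst h2 rc (Permutation.Permutation_refl _)).
Qed.

(** Both completions of a coloured graph are smaller and again coloured, so any small cut may be
    used until none is left. *)
Lemma refine_colourable n (G H : graph) (phi : gE H -> option (gE G)) s :
  #|gV H| < n -> good_graph H -> colourable3 H -> stage (mkfactor phi :: s) ->
  exists s', stage (s' ++ s) /\
    forall F, List.In F s' -> cyc_conn (projT1 F) 4 /\ colourable3 (projT1 F).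
Proof.
elim: n H phi s => // n IH H phi s Hn good col st.
have [cyc|[X [X1 X1' X3]]] := cyc_conn4_or_cut good.
  by exists [:: mkfactor phi]; split=> // F [<-|].
have [Y [iY Y1 Y1' Y3 _]] := indep_cut_refine good X3 X1 X1'.
have [K1 [K2 [psi1 [psi2 [c1 c2 st2]]]]] := stage_step good iY Y1 Y1' Y3 st.
have cH : forall Z, @colourable_on H Z.
  by move=> Z; have [c hc] := (colourable3P good).1 col; exists c => v _; apply: hc; rewrite inE.
have lt1 : #|gV K1| < n by have := cp_card c1; move: Hn; nlia.
have lt2 : #|gV K2| < n by have := cp_card c2; move: Hn; nlia.
have [s1 [st3 h1]] := IH _ _ _ lt1 (cp_good c1) ((cp_colour c1).2 (cH _)) st2.
have st4 := stage_perm st3 (Permutation.Permutation_sym (Permutation.Permutation_middle _ _ _)).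
have [s2 [st5 h2]] := IH _ _ _ lt2 (cp_good c2) ((cp_colour c2).2 (cH _)) st4.
exists (s2 ++ s1); split; first by rewrite -catA.
by move=> F /(List.in_app_or s2 s1) [/h2|/h1].
Qed.

Section CoreSide.
Variables (G H K : graph) (phi : gE H -> option (gE G)) (X : {set gV H}).
Variables (psi : gE K -> option (gE H)) (C : {set gE G}).
Variables (m : 'I_3 -> {set gE H}) (D : 'I_3 -> gE H).
Hypotheses (good : good_graph H) (ncol : ~ colourable3 H) (X3 : #|cut X| <= 3).
Hypotheses (sk : skeleton m D) (free : core_free D (~: X)) (cp : completion X psi).

(** A colouring of [K] would colour [X], and the core-free side is coloured by two matchings; the
    two could be glued. *)
Lemma core_side_uncolourable : ~ colourable3 K.
Proof.
move=> /(cp_colour cp) cX; apply: ncol; apply: (colourable_glue good X3 cX).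
by apply: (colourable_on_skeleton good sk (i := ord0)) => v vX; apply: free.
Qed.

(** An uncovered edge of [K] comes from an uncovered edge of [H], injectively, because the new edge
    of a 2-cut completion is simply covered. So at most three edges are missed. *)
Lemma core_side_skeleton : pull phi C = [set e | mult m e != 1] ->
  exists m' D', skeleton m' D' /\
    pull (fun k => obind phi (psi k)) C = [set k | mult m' k != 1].
Proof.
move=> eC; have [m' arr' hm'] := cp_array cp sk free.
have le3 : #|misses m'| <= 3.
  apply: leq_trans (sk_misses sk); pose f k := odflt (D ord0) (psi k).
  have in_m k : k \in misses m' -> exists2 e, psi k = Some e & e \in misses m.
    by rewrite inE hm'; case: (psi k) => // e he; exists e; rewrite ?inE.
  rewrite -(card_in_imset (f := f)).
    by apply/subset_leq_card/subsetP=> _ /imsetP [k /in_m [e he em] ->]; rewrite /f he.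
  move=> k k' /in_m [e he _] /in_m [e' he' _]; rewrite /f he he' /= => ee.
  by apply: (cp_inj cp he); rewrite ee.
have [_ [D' sk']] := skeletonI (cp_good cp) arr' core_side_uncolourable le3.
exists m', D'; split=> //; apply/setP=> k; rewrite !inE hm'.
case hk: (psi k) => [e|] //=; have := in_set (fun e => mult m e != 1) e.
by rewrite -eC inE.
Qed.

Lemma core_side_cover : pull phi C = [set e | mult m e != 1] ->
  (forall c, c \in C -> exists e, phi e = Some c) ->
  forall c, c \in C -> exists k, obind phi (psi k) = Some c.
Proof.
move=> eC cov c cC; have [e he] := cov c cC.
have em : mult m e != 1.
  by have := in_set (fun e => mult m e != 1) e; rewrite -eC inE he cC => <-.
have [ll _ _ _] := good.
have inX b : gends e b \in X.
  apply: contraNT em => bX; rewrite -in_setC in bX.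
  by rewrite (off_skeleton good sk (fun i => @free _ i bX) (star_end ll e b)).
have [k hk] := cp_inside cp (introT andP (conj (inX false) (inX true))).
by exists k; rewrite hk.
Qed.

End CoreSide.

Lemma decomposition_exists n (G : graph) (C : {set gE G}) (H : graph)
    (phi : gE H -> option (gE G)) s m D :
  #|gV H| < n -> good_graph H -> ~ colourable3 H -> @skeleton H m D ->
  pull phi C = [set e | mult m e != 1] ->
  (forall c, c \in C -> exists e, phi e = Some c) ->
  stage (mkfactor phi :: s) ->
  (forall F, List.In F s -> cyc_conn (projT1 F) 4 /\ colourable3 (projT1 F)) ->
  exists (G1 : graph) (phi1 : gE G1 -> option (gE G)) (rest : seq (factor G)),
    [/\ stage (mkfactor phi1 :: rest),
        forall F, List.In F rest -> cyc_conn (projT1 F) 4 /\ colourable3 (projT1 F),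
        [/\ defect G1 3, hexcore G1 (pull phi1 C)
          & forall c, c \in C -> exists k, phi1 k = Some c]
      & ~ cyc_conn G1 4 ->
           exists (a b c : gV G1) (t1 t2 t3 : gE G1),
             [/\ [&& a != b, b != c & c != a],
                 [&& joins t1 a b, joins t2 b c & joins t3 c a],
                 [set a; b; c] :&: touched (pull phi1 C) != set0
               & cyc_conn (contract [set a; b; c] [set t1; t2; t3]) 4]].
Proof.
elim: n H phi s m D => // n IH H phi s m D Hn good ncol sk eC cov st hs.
pose bad (W : {set gV H}) :=
  [&& [forall v in W, [forall i, D i \notin star v]], 1 < #|W| & #|cut W| <= 3].
have [/existsP [W /and3P [/forall_inP fW W1 W3]]|no] := boolP [exists W, bad W]; last first.
  have irred W : core_free D W -> 1 < #|W| -> #|cut W| <= 3 -> False.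
    move=> fW W1 W3; case/negP: no; apply/existsP; exists W; apply/and3P; split=> //.
    by apply/forall_inP=> v vW; apply/forallP=> i; apply: fW.
  have [df hc] := skeleton_defect good ncol sk.
  exists H, phi, s; split=> //; first by split=> //; rewrite eC.
  exact: (irreducible_factor good ncol sk irred eC).
have free : core_free D W by move=> v i /fW /forallP.
have [ll _ _ _] := good.
have out b : gends (D ord0) b \in ~: W.
  by rewrite inE; apply/negP=> bW; have := free _ ord0 bW; rewrite star_end.
have W1' : 1 < #|~: W|.
  by apply/card_gt1P; exists (gends (D ord0) false), (gends (D ord0) true); split.
have [Y [iY Y1 Y1' Y3 hY]] := indep_cut_refine good W3 W1 W1'.
(* The refinement may add a vertex [w] with two edges in [cut W]. Both are simply covered, whereas
   an end of some [D i] has at most one such edge, so [w] is off the core as well. *)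
have freeY : core_free D Y.
  case: hY => [/subsetP sY v i /sY|[w [-> hw]]]; first exact: free.
  move=> v i; rewrite in_setU1 => /orP [/eqP ->|]; last exact: free.
  apply/negP=> Dw; have [u [g [[uw gw um] [gi uD gD] ug all]]] := at_skeleton good sk Dw.
  have one e : e \in cut W -> mult m e = 1.
    by case/cutP=> b [bW _]; apply: (off_skeleton good sk (free _ ^~ bW)); apply: star_end.
  have sub e : e \in cut W :&: star w -> e = g.
    rewrite in_setI => /andP [eW ew]; have := one e eW; case/or3P: (all e ew) => /eqP -> //.
      by rewrite (mult_skeleton sk).
    by move: um; rewrite inE => /eqP ->.
  by case/card_gt1P: hw => e [f [/sub -> /sub ->]]; rewrite eqxx.
(* [X] is the side carrying the core: its completion [K1] continues the induction, and [K2] is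
   coloured and refined at once. *)
pose X := ~: Y; have eX : ~: X = Y by rewrite setCK.
have iX : indep_cut X by case: iY => a b c; split; rewrite ?setCK ?cutC.
have X3 : #|cut X| <= 3 by rewrite cutC.
have X1' : 1 < #|~: X| by rewrite eX.
have [K1 [K2 [psi1 [psi2 [c1 c2 st2]]]]] := stage_step good iX Y1' X1' X3 st.
have freeX : core_free D (~: X) by rewrite eX.
have col2 : colourable3 K2.
  apply/(cp_colour c2); apply: (colourable_on_skeleton good sk (i := ord0)).
  by move=> v; apply: freeX.
have st3 := stage_perm st2 (Permutation.perm_swap _ _ _).
have [s' [st4 hs']] := refine_colourable (ltnSn _) (cp_good c2) col2 st3.
have st5 := stage_perm st4 (Permutation.Permutation_sym (Permutation.Permutation_middle _ _ _)).
have [m' [D' [sk' eC']]] := core_side_skeleton good ncol X3 sk freeX c1 eC.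
have lt1 : #|gV K1| < n by have := cp_card c1; move: Hn; nlia.
apply: (IH K1 _ _ m' D' lt1 (cp_good c1) _ sk' eC' _ st5).
- exact: (core_side_uncolourable good ncol X3 sk freeX c1).
- exact: (core_side_cover good sk freeX c1 eC cov).
by move=> F /(List.in_app_or s' s) [/hs'|/hs].
Qed.

Theorem theorem4p3 (G : graph) (C : {set gE G}) :
  cubic G -> twoconn G -> defect G 3 -> hexcore G C ->
  exists (G1 : graph) (phi1 : gE G1 -> option (gE G)) (rest : seq (factor G)),
    [/\ decomp (existT _ G1 phi1 :: rest)
         /\ (forall F, List.In F rest -> cyc_conn (projT1 F) 4),
        (* (i) *)
        [/\ defect G1 3, hexcore G1 (pull phi1 C)
          & forall c, c \in C -> exists k, phi1 k = Some c],
        (* (ii) *)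
        (forall F, List.In F rest -> colourable3 (projT1 F)),
        (* (iii) *)
        (~ cyc_conn G1 4 ->
           exists (a b c : gV G1) (t1 t2 t3 : gE G1),
             [/\ [&& a != b, b != c & c != a],
                 [&& joins t1 a b, joins t2 b c & joins t3 c a],
                 [set a; b; c] :&: touched (pull phi1 C) != set0
               & cyc_conn (contract [set a; b; c] [set t1; t2; t3]) 4])
      & (* reconstruction *)
        recon G (G1 :: map (fun F => projT1 F) rest)].
Proof.
move=> cub two df hex; have good : good_graph G by apply/good_graphP.
have ncol := defect3_uncolourable good df.
have [m [D [sk eC]]] := hexcore_skeleton good df hex.
have eP : pull (@Some (gE G)) C = [set e | mult m e != 1].
  by rewrite -eC; apply/setP=> e; rewrite inE.
have st : stage [:: mkfactor (@Some (gE G))].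
  by split; [exact: dec_base|exact: rc_leaf].
have [||G1 [phi1 [rest [[dc rc] hr h3 htri]]]] :=
  decomposition_exists (ltnSn _) good ncol sk eP _ st.
- by move=> c _; exists c.
- by [].
exists G1, phi1, rest; split=> //.
- by split=> // F /hr [].
- by move=> F /hr [].
Qed.
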